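(* Let $(M,\widetilde B)$ be a root of unity quantum seed satisfying condition (Coprime). Then there is a unique isomorphism of labelled graphs from the exchange graph $E_\varepsilon(M,\widetilde B)$ to the exchange graph $E(\widetilde B)$ which sends the vertex corresponding to the seed $(M,\widetilde B)$ to the vertex corresponding to the classical seed $(\widetilde{\mathbf x},\widetilde B)$, where $\widetilde{\mathbf x}=(M(e_1)^\ell,\dots,M(e_N)^\ell)$.
   Context: Let $\ell$ be a positive integer, $\mathbb Z_\ell=\mathbb Z/\ell\mathbb Z$, $\varepsilon^{1/2}\in\mathbb C$ a primitive $\ell$-th root of unity, $\mathcal A^{1/2}_\varepsilon=\mathbb Z[\varepsilon^{1/2}]$, and $\varepsilon^{a/2}=(\varepsilon^{1/2})^a$ for $a\in\mathbb Z_\ell$. $\overline C$ is the reduction mod $\ell$ of an integer matrix $C$; $e_1,\dots,e_N$ is the standard basis of $\mathbb Z^N$. For a skew-symmetric bilinear form $\Lambda:\mathbb Z^N\times\mathbb Z^N\to\mathbb Z_\ell$ with matrix $(\lambda_{ij})$, $\mathcal T_\varepsilon(\Lambda)$ is the $\mathcal A^{1/2}_\varepsilon$-algebra with basis $\{X^f\}_{f\in\mathbb Z^N}$ and $X^fX^g=\varepsilon^{\Lambda(f,g)/2}X^{f+g}$. A root of unity toric frame of a division algebra $\mathcal F$ over $\mathbb Q(\varepsilon^{1/2})$ is a map $M:\mathbb Z^N\to\mathcal F$ such that for some (unique) skew-symmetric $\Lambda=:\Lambda_M$ there is an injective $\mathcal A^{1/2}_\varepsilon$-algebra map $\phi:\mathcal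 T_\varepsilon(\Lambda)\to\mathcal F$, $\phi(X^f)=M(f)$, with $\mathcal F$ the skew field of fractions of its image. Fix $\mathrm{ex}\subseteq[1,N]$. An exchange matrix $\widetilde B=(b_{ij})$ is an integer matrix with rows indexed by $[1,N]$, columns by $\mathrm{ex}$, principal part $B$, $k$-th column $b^k$. $(\Lambda,\widetilde B)$ is $\ell$-compatible if there is $D=\mathrm{diag}(d_j)_{j\in\mathrm{ex}}$, $d_j\in\mathbb Z_{>0}$, with $DB$ skew-symmetric and $\sum_k\overline b_{kj}\lambda_{ki}=\delta_{ij}\overline d_j$ in $\mathbb Z_\ell$ for all $i\in[1,N]$, $j\in\mathrm{ex}$. A root of unity quantum seed is $(M,\widetilde B)$ with $(\Lambda_M,\widetilde B)$ $\ell$-compatible. Condition (Coprime): $\ell$ is odd and coprime to all $d_k$, $k\in\mathrm{ex}$. For $b\in\mathbb Z^N$, $[b]_\pm$ keeps the entries $b_i$ with $\pm b_i\ge0$ and sets the others to $0$. Mutation in direction $k\in\mathrm{ex}$: $\mu_k(\widetilde B)=(b'_{ij})$, $b'_{ij}=-b_{ij}$ if $i=k$ or $j=k$, otherwise $b'_{ij}=b_{ij}+(|b_{ik}|b_{kj}+b_{ik}|b_{kj}|)/2$; $\mu_k(M)$ is the root of unity toric frame with matrix $\overline E^\top\Lambda_M\overline E$ ($E$: $e_{ij}=\delta_{ij}$ for $j\neq k$, $e_{kk}=-1$, $e_{ik}=\max(0,-b_{ik})$ for $i\ne k$) and $\mu_k(M)(e_j)=M(e_j)$ ($j\ne k$),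 $\mu_k(M)(e_k)=M(-e_k+[b^k]_+)+M(-e_k-[b^k]_-)$. The exchange graph $E_\varepsilon(M,\widetilde B)$ is the labelled graph whose vertices correspond to the root of unity quantum seeds mutation-equivalent to $(M,\widetilde B)$ and whose edges are seed mutations $\mu_k$, labelled by $k$. Classically, for a seed $(\widetilde{\mathbf x},\widetilde B)$ ($\widetilde{\mathbf x}=(x_1,\dots,x_N)$ a transcendence basis generating a field over $\mathbb Q$), mutation $\mu_k$ replaces $x_k$ by $x_k'$ with $x_kx_k'=\prod_{b_{ik}>0}x_i^{b_{ik}}+\prod_{b_{ik}<0}x_i^{-b_{ik}}$ and $\widetilde B$ by $\mu_k(\widetilde B)$; the exchange graph $E(\widetilde B)$ is the labelled graph with vertices corresponding to seeds mutation-equivalent to $(\widetilde{\mathbf x},\widetilde B)$ and edges given by mutations labelled by their directions. A map of labelled graphs is a graph map preserving edge labels. (Here $M(e_1)^\ell,\dots,M(e_N)^\ell$ are algebraically independent commuting elements, so $(\widetilde{\mathbf x},\widetilde B)$ is a classical seed in the field they generate.) *)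

(* Defs.v *)
From HB Require Import structures.
From mathcomp Require Import all_boot all_order all_algebra.
Set Implicit Arguments. Unset Strict Implicit. Unset Printing Implicit Defensive.
Import Order.TTheory GRing.Theory Num.Theory.
Local Open Scope ring_scope.

Definition exT (N : nat) (ex : {set 'I_N}) := {j : 'I_N | j \in ex}.

Definition exmat (N : nat) (ex : {set 'I_N}) := 'I_N -> exT ex -> int.

Definition evec (N : nat) (i : 'I_N) : 'rV[int]_N := delta_mx 0 i.

Definition bil (N : nat) (lam : 'M[int]_N) (f g : 'rV[int]_N) : int :=
  (f *m lam *m g^T) 0 0.

Definition posp (N : nat) (b : 'rV[int]_N) : 'rV[int]_N :=
  \row_i (if 0 <= b 0 i then b 0 i else 0).
Definition negp (N : nat) (b : 'rV[int]_N) : 'rV[int]_N :=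
  \row_i (if 0 <= - b 0 i then b 0 i else 0).

Definition bcol (N : nat) (ex : {set 'I_N}) (B : exmat ex) (k : exT ex)
  : 'rV[int]_N := \row_i B i k.

Definition mutB (N : nat) (ex : {set 'I_N}) (k : exT ex) (B : exmat ex)
  : exmat ex :=
  fun i j =>
    if (i == val k) || (j == k) then - B i j
    else B i j + ((`|B i k| * B (val k) j + B i k * `|B (val k) j|) %/ 2)%Z.

Definition mutE (N : nat) (ex : {set 'I_N}) (k : exT ex) (B : exmat ex)
  : 'M[int]_N :=
  \matrix_(i, j)
    if j == val k then (if i == val k then -1 else Num.max 0 (- B i k))
    else (i == j)%:R.

(* ell-compatibility of (Lambda, B~) with witness D = diag(d_j); the    *)
(* matrix lam of Lambda is represented by integers, read modulo ell.    *)
Definition compatible (l N : nat) (ex : {set 'I_N}) (lam : 'M[int]_N)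
  (B : exmat ex) (d : exT ex -> nat) : Prop :=
  [/\ forall j, (0 < d j)%N,
      forall i j : exT ex, (d i)%:Z * B (val i) j = - ((d j)%:Z * B (val j) i)
    & forall (i : 'I_N) (j : exT ex),
        (\sum_(k < N) B k j * lam k i
           = (if i == val j then (d j)%:Z else 0) %[mod (l%:Z)])%Z ].

Section Frames.
Variables (K : fieldType) (F : unitAlgType K) (l N : nat) (z : K).
(* z plays the role of eps^{1/2}; eps^{a/2} = z ^ a *)

Definition inA (c : K) : Prop :=
  exists p : {poly int}, c = (map_poly (fun n : int => n%:~R) p).[z].

(* root of unity toric frame with (integer representative of) matrix lam: *)
(* phi : T_eps(Lambda) -> F, X^f |-> M f, is an injective A-algebra map   *)
(* (written out: unit, multiplicativity, A-linear independence), and F is *)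
(* the skew field generated by its image.                                  *)
Definition toric_frame (M : 'rV[int]_N -> F) (lam : 'M[int]_N) : Prop :=
  [/\ forall i j, (lam i j = - lam j i %[mod (l%:Z)])%Z,
      M 0 = 1,
      forall f g, M f * M g = (z ^ bil lam f g) *: M (f + g),
      forall (s : seq 'rV[int]_N) (c : 'rV[int]_N -> K),
        uniq s -> (forall f, f \in s -> inA (c f)) ->
        \sum_(f <- s) c f *: M f = 0 -> forall f, f \in s -> c f = 0
    & forall S : F -> Prop,
        (forall f, S (M f)) -> S (z%:A) ->
        (forall x y, S x -> S y -> S (x - y)) ->
        (forall x y, S x -> S y -> S (x * y)) ->
        (forall x, S x -> S x^-1) ->
        forall x, S x ].

Variable ex : {set 'I_N}.

Definition qseed := (('rV[int]_N -> F) * exmat ex)%type.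

Definition is_qseed (s : qseed) : Prop :=
  exists lam d, toric_frame s.1 lam /\ compatible l lam s.2 d.

Definition qmut (k : exT ex) (s s' : qseed) : Prop :=
  s'.2 = mutB k s.2 /\
  exists lam, toric_frame s.1 lam /\
    toric_frame s'.1 ((mutE k s.2)^T *m lam *m mutE k s.2) /\
    (forall j : 'I_N, j != val k -> s'.1 (evec j) = s.1 (evec j)) /\
    s'.1 (evec (val k)) =
      s.1 (- evec (val k) + posp (bcol s.2 k))
      + s.1 (- evec (val k) - negp (bcol s.2 k)).

Definition cseed := (('I_N -> F) * exmat ex)%type.

Definition cmut (k : exT ex) (c c' : cseed) : Prop :=
  c'.2 = mutB k c.2 /\
  (forall j : 'I_N, j != val k -> c'.1 j = c.1 j) /\
  c.1 (val k) * c'.1 (val k) =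
    \prod_(i < N | 0 < c.2 i k) c.1 i ^+ `|c.2 i k|%N
    + \prod_(i < N | c.2 i k < 0) c.1 i ^+ `|c.2 i k|%N.

End Frames.

Inductive reach (T L : Type) (R : L -> T -> T -> Prop) (x : T) : T -> Prop :=
| reach_refl : reach R x x
| reach_step : forall y w k, reach R x y -> R k y w -> reach R x w.

Definition qvertex (K : fieldType) (F : unitAlgType K) (l N : nat) (z : K)
  (ex : {set 'I_N}) (s0 s : qseed F ex) : Prop :=
  reach (@qmut K F l N z ex) s0 s /\ is_qseed l z s.

Definition cvertex (K : fieldType) (F : unitAlgType K) (N : nat)
  (ex : {set 'I_N}) (c0 c : cseed F ex) : Prop :=
  reach (@cmut K F N ex) c0 c.

(* Main.v *)
Require Import Defs.
From HB Require Import structures.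
From mathcomp Require Import all_boot all_order all_algebra.
From mathcomp Require Import ring zify.
From Stdlib Require Import ClassicalEpsilon FunctionalExtensionality ProofIrrelevance.
Import Order.TTheory GRing.Theory Num.Theory.
Local Open Scope ring_scope.
Set Implicit Arguments. Unset Strict Implicit. Unset Printing Implicit Defensive.

(* A seed is sent to the l-th powers of its cluster variables.  The two monomials
   of an exchange relation quasi-commute up to a primitive l-th root of unity, so
   taking l-th powers kills the mixed terms and turns quantum mutation into
   classical mutation; this gives a graph map, surjective because paths lift.
   For injectivity one must show that a mutation path from (M, B) to (M', B) with
   M'(e_i)^l = M(e_i)^l has M' = M.  First, a Laurent phenomenon: M'(e_i) lies in
   the quantum torus of M.  Along t0 -i- t1 -j- t2 and t2 -i- t3 it lies by
   induction in the tori of t1 and t3, so its denominators can be taken to be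
   powers of the central elements p = x_i(t1)^l and q r, where q = x_j(t2)^l and
   r = x_i(t3)^l; q and r are regular modulo p, so no denominator is left.
   Second, for every total group order on Z^N the leading term of M'(e_i) in this
   torus is a normalized monomial M(g), by induction on the path.  As M'(e_i)^l is
   the monomial M(e_i)^l, the leading terms for an order and for its opposite are
   both M(e_i), whence M'(e_i) = M(e_i). *)

(** The obstacle to injectivity is that M(e_i)^l is central in the skew field: every conjugate of
    M(e_i) has the same l-th power, so the classical variables alone do not determine the quantum
    ones. The mutation path has to be used, and it enters through finite supports. The Laurent
    phenomenon turns each variable into a finite sum of monomials, so that it has a highest and a
    lowest term. The coefficient 1 of these terms survives mutation because the form of the last
    seed is the pullback of the form of the first along the matrix [Phi] of leading exponents.
    Taking l-th powers as denominators makes them central, which lets the usual argument with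
    coprime denominators run in a noncommutative ring. Condition (Coprime) enters through z^(2 d_k)
    being primitive, through z^(d_k) differing from 1 when l > 1, and through odd l, which recovers
    an l-th root of unity from its square; commutation relations only see such squares. For l = 1
    nothing is lost by taking powers, and that case is separated at the end. *)

Section TwistedMonomials.

(** * Bicharacters, twisted monomials and their spans *)

Variables (K : fieldType) (F : unitAlgType K) (N : nat).
Local Notation V := 'rV[int]_N.

Lemma row_int_ind (P : V -> Prop) :
  P 0 -> (forall f i, P f -> P (f + evec i)) ->
  (forall f i, P f -> P (f - evec i)) -> forall f, P f.
Proof.
move=> P0 PD PB.
have Pz f i (a : int) : P f -> P (f + a *: evec i).
  move=> Pf; elim/int_ind: a => [|n|n]; first by rewrite scale0r addr0.
    by move=> H; rewrite intS (addrC 1) scalerDl scale1r addrA; apply: PD.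
  by move=> H; rewrite intS (addrC 1) opprD scalerDl scaleN1r addrA; apply: PB.
move=> f; rewrite [f]row_sum_delta; elim/big_rec: _ => // i x _ Px.
by rewrite addrC; apply: Pz.
Qed.

(* q f g stands for eps^(Lambda(f,g)/2). *)
Definition bichar (q : V -> V -> K) : Prop :=
  [/\ forall f g h, q (f + g) h = q f h * q g h,
      forall f g, q f g * q g f = 1
    & forall f, q f f = 1].

Section Bichar.
Variables (q : V -> V -> K) (hq : bichar q).

Lemma bichar_neq0 f g : q f g != 0.
Proof.
case: hq => _ h _; apply: contra_eq_neq (h f g) => ->.
by rewrite mul0r eq_sym oner_eq0.
Qed.

Lemma bicharDl f g h : q (f + g) h = q f h * q g h.
Proof. by case: hq. Qed.

Lemma bichar_diag f : q f f = 1.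
Proof. by case: hq. Qed.

Lemma bicharC f g : q g f = (q f g)^-1.
Proof. by case: hq => _ h _; apply: (mulfI (bichar_neq0 f g)); rewrite h divff ?bichar_neq0. Qed.

Lemma bicharDr f g h : q f (g + h) = q f g * q f h.
Proof. by rewrite bicharC bicharDl invfM -!bicharC. Qed.

Lemma bichar0l f : q 0 f = 1.
Proof. by apply: (mulfI (bichar_neq0 0 f)); rewrite -bicharDl addr0 mulr1. Qed.

Lemma bichar0r f : q f 0 = 1.
Proof. by rewrite bicharC bichar0l invr1. Qed.

Lemma bicharNl f g : q (- f) g = (q f g)^-1.
Proof. by apply: (mulfI (bichar_neq0 f g)); rewrite -bicharDl subrr bichar0l divff ?bichar_neq0. Qed.

Lemma bicharNr f g : q f (- g) = (q f g)^-1.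
Proof. by rewrite bicharC bicharNl -bicharC. Qed.

Lemma bicharMnl f g n : q (f *+ n) g = q f g ^+ n.
Proof. by elim: n => [|n IH]; rewrite ?mulr0n ?bichar0l // mulrS bicharDl IH exprS. Qed.

Lemma bicharMnr f g n : q f (g *+ n) = q f g ^+ n.
Proof. by rewrite bicharC bicharMnl -exprVn -bicharC. Qed.

End Bichar.

(** Only the multiplication rule of a toric frame is kept. The l-th powers of a toric frame satisfy
    it too, with [q] constantly 1, so lemmas on frames serve for both families. *)
Definition frame (M : V -> F) (q : V -> V -> K) : Prop :=
  [/\ bichar q, M 0 = 1 & forall f g, M f * M g = q f g *: M (f + g)].

Section Frame.
Variables (M : V -> F) (q : V -> V -> K) (hM : frame M q).
Let hq : bichar q. Proof. by case: hM. Qed.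

Lemma frameM f g : M f * M g = q f g *: M (f + g).
Proof. by case: hM. Qed.

Lemma frame0 : M 0 = 1.
Proof. by case: hM. Qed.

Lemma frameD f g : M (f + g) = (q f g)^-1 *: (M f * M g).
Proof. by rewrite frameM scalerA mulVf ?scale1r ?bichar_neq0. Qed.

Lemma frame_comm f g : M f * M g = (q f g) ^+ 2 *: (M g * M f).
Proof.
rewrite !frameM scalerA (addrC g) expr2 (bicharC hq f g).
by rewrite -mulrA mulfV ?mulr1 ?bichar_neq0.
Qed.

Lemma frameNl f : M (- f) * M f = 1.
Proof. by rewrite frameM addNr frame0 (bicharNl hq) (bichar_diag hq) invr1 scale1r. Qed.

Lemma frameNr f : M f * M (- f) = 1.
Proof. by rewrite frameM subrr frame0 (bicharNr hq) (bichar_diag hq) invr1 scale1r. Qed.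

Lemma frame_unit f : M f \is a GRing.unit.
Proof. by apply/unitrP; exists (M (- f)); rewrite frameNl frameNr. Qed.

Lemma frameN f : M (- f) = (M f)^-1.
Proof. by apply: (mulrI (frame_unit f)); rewrite frameNr divrr ?frame_unit. Qed.

Lemma frame_neq0 f : M f != 0.
Proof. by apply: contraTneq (frame_unit f) => ->; rewrite unitr0. Qed.

Lemma frameMn f n : M (f *+ n) = M f ^+ n.
Proof.
elim: n => [|n IH]; first by rewrite mulr0n frame0 expr0.
by rewrite mulrS frameD IH (bicharMnr hq) (bichar_diag hq) expr1n invr1 scale1r exprS.
Qed.

End Frame.

Inductive mspan (M : V -> F) (P : V -> Prop) : F -> Prop :=
| mspan0 : mspan M P 0
| mspanS c f x : P f -> mspan M P x -> mspan M P (c *: M f + x).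

Section Span.
Variable M : V -> F.

Lemma mspan_sub (P Q : V -> Prop) x :
  (forall f, P f -> Q f) -> mspan M P x -> mspan M Q x.
Proof.
move=> PQ; elim=> [|c f y /PQ Pf _ IH]; [exact: mspan0 | exact: mspanS].
Qed.

Lemma mspanD P x y : mspan M P x -> mspan M P y -> mspan M P (x + y).
Proof.
move=> hx hy; elim: hx => [|c f z Pf _ IH]; first by rewrite add0r.
by rewrite -addrA; apply: mspanS.
Qed.

Lemma mspanZ P a x : mspan M P x -> mspan M P (a *: x).
Proof.
elim=> [|c f y Pf _ IH]; first by rewrite scaler0; apply: mspan0.
by rewrite scalerDr scalerA; apply: mspanS.
Qed.

Lemma mspanN P x : mspan M P x -> mspan M P (- x).
Proof. by rewrite -scaleN1r; apply: mspanZ. Qed.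

Lemma mspanB P x y : mspan M P x -> mspan M P y -> mspan M P (x - y).
Proof. by move=> hx /mspanN; apply: mspanD. Qed.

Lemma mspan_mon (P : V -> Prop) f : P f -> mspan M P (M f).
Proof.
by move=> Pf; rewrite -[M f]scale1r -[_ *: _]addr0; apply: mspanS (mspan0 _ _).
Qed.

Lemma mspan_all (P : V -> Prop) x : mspan M P x -> mspan M (fun=> True) x.
Proof. exact: mspan_sub. Qed.

Lemma mspan_none (P : V -> Prop) x : (forall f, ~ P f) -> mspan M P x -> x = 0.
Proof. by move=> h [//|c f y /h]. Qed.

Lemma mspan_split (P : V -> Prop) (b : pred V) x : mspan M P x ->
  exists y z, [/\ x = y + z, mspan M (fun f => P f /\ b f) y
                & mspan M (fun f => P f /\ ~~ b f) z].
Proof.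
elim=> [|c f t Pf _ [y [z [-> hy hz]]]].
  by exists 0, 0; rewrite addr0; split=> //; apply: mspan0.
case bf: (b f).
  by exists (c *: M f + y), z; rewrite addrA; split=> //; apply: mspanS.
exists y, (c *: M f + z); rewrite addrCA; split=> //; apply: mspanS => //.
by rewrite bf.
Qed.

Variables (q : V -> V -> K) (hM : frame M q).

Lemma mspanM (P Q R : V -> Prop) x y :
  (forall f g, P f -> Q g -> R (f + g)) ->
  mspan M P x -> mspan M Q y -> mspan M R (x * y).
Proof.
move=> PQR hx hy; elim: hx => [|c f z Pf _ IH]; first by rewrite mul0r; apply: mspan0.
rewrite mulrDl; apply: mspanD => //; rewrite -scalerAl; apply: mspanZ => {IH}.
elim: hy => [|d g t Qg _ IH]; first by rewrite mulr0; apply: mspan0.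
rewrite mulrDr; apply: mspanD => //; rewrite -scalerAr (frameM hM) scalerA.
by apply: mspanZ; apply: mspan_mon; apply: PQR.
Qed.

Lemma mspan_allM x y : mspan M (fun=> True) x -> mspan M (fun=> True) y ->
  mspan M (fun=> True) (x * y).
Proof. by apply: mspanM. Qed.

Lemma mspan_all1 : mspan M (fun=> True) 1.
Proof. by rewrite -(frame0 hM); apply: mspan_mon. Qed.

Lemma mspan_allX x n : mspan M (fun=> True) x -> mspan M (fun=> True) (x ^+ n).
Proof.
move=> hx; elim: n => [|n IH]; first exact: mspan_all1.
by rewrite exprS; apply: mspan_allM.
Qed.

End Span.

Definition free_mon (M : V -> F) : Prop :=
  forall (s : seq V) (c : V -> K), uniq s ->
    \sum_(f <- s) c f *: M f = 0 -> forall f, f \in s -> c f = 0.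

(* Linear independence makes it meaningful to discard the monomials outside P. *)
Lemma proj_exists (M : V -> F) (P : pred V) : free_mon M ->
  exists pi : F -> F, pi 0 = 0 /\
    forall c f x, mspan M (fun=> True) x ->
      pi (c *: M f + x) = (if P f then c *: M f else 0) + pi x.
Proof.
move=> freeM.
pose ev (s : seq (K * V)) := \sum_(t <- s) t.1 *: M t.2.
pose fs (s : seq (K * V)) := [seq t <- s | P t.2].
have ev_cat s t : ev (s ++ t) = ev s + ev t by rewrite /ev big_cat.
have fs_cat s t : fs (s ++ t) = fs s ++ fs t by rewrite /fs filter_cat.
(* A list may repeat an exponent, so the coefficients at each exponent are first gathered into [c],
   to which independence applies. *)
have ev_fs0 s : ev s = 0 -> ev (fs s) = 0.
  pose c f := \sum_(t <- s | t.2 == f) t.1.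
  pose u := undup [seq t.2 | t <- s].
  have gen (b : pred V) : \sum_(t <- s | b t.2) t.1 *: M t.2 =
                          \sum_(f <- u | b f) c f *: M f.
    under [RHS]eq_bigr do rewrite scaler_suml.
    rewrite (exchange_big_dep xpredT) //= big_mkcond /=.
    apply: eq_big_seq => t ts; rewrite [RHS]big_mkcond /=.
    rewrite (bigD1_seq t.2) ?undup_uniq //=; last first.
      by rewrite mem_undup; apply: map_f.
    rewrite eqxx andbT big1 ?addr0 // => f ft.
    by rewrite eq_sym (negPf ft) andbF.
  rewrite /ev /fs big_filter gen (gen xpredT) => H.
  rewrite big1_seq // => f /andP[_ fu].
  by rewrite (freeM u c) ?scale0r // undup_uniq.
pose neg s := [seq (- t.1, t.2) | t : K * V <- s].
have ev_neg s : ev (neg s) = - ev s.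
  by rewrite /ev big_map -sumrN; apply: eq_bigr => t _; rewrite scaleNr.
have fs_neg s : fs (neg s) = neg (fs s) by rewrite /fs filter_map.
have ev_fs s t : ev s = ev t -> ev (fs s) = ev (fs t).
  move=> st; apply/eqP; rewrite -subr_eq0 -ev_neg -fs_neg -ev_cat -fs_cat.
  by apply/eqP/ev_fs0; rewrite ev_cat ev_neg st subrr.
have ev_span x : mspan M (fun=> True) x -> exists s, x = ev s.
  elim=> [|c f y _ _ [s ->]]; first by exists [::]; rewrite /ev big_nil.
  by exists ((c, f) :: s); rewrite /ev big_cons.
(* An arbitrary expression of [x] is chosen; [ev_fs] shows that the filtered value does not depend
   on it. *)
pose pi x := ev (fs (epsilon (inhabits [::]) (fun s => x = ev s))).
have piE s : pi (ev s) = ev (fs s).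
  apply: ev_fs; rewrite -(epsilon_spec (inhabits [::]) (fun t => ev s = ev t)) //.
  by exists s.
exists pi; split; first by rewrite -[0](_ : ev [::] = 0) ?piE // /ev big_nil.
move=> c f x /ev_span[s ->].
rewrite -[_ + _](_ : ev ((c, f) :: s) = _); last by rewrite /ev big_cons.
rewrite !piE /fs /=; case: ifP => _; last by rewrite add0r.
by rewrite /ev big_cons.
Qed.

End TwistedMonomials.

(** * Regularity modulo a central element *)

Section Regularity.

Variables (K : fieldType) (F : unitAlgType K) (N : nat).
Local Notation V := 'rV[int]_N.

Definition is_proj (M : V -> F) (P : pred V) (pi : F -> F) : Prop :=
  pi 0 = 0 /\
  forall c f x, mspan M (fun=> True) x ->
    pi (c *: M f + x) = (if P f then c *: M f else 0) + pi x.

Section Projections.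
Variable M : V -> F.

Lemma projD P pi x y : is_proj M P pi ->
  mspan M (fun=> True) x -> mspan M (fun=> True) y -> pi (x + y) = pi x + pi y.
Proof.
case=> pi0 piS hx hy; elim: hx => [|c f z _ hz IH]; first by rewrite pi0 !add0r.
rewrite -addrA !piS ?IH ?addrA //; exact: mspanD.
Qed.

Lemma proj_in (P : pred V) (Q : V -> Prop) pi x : is_proj M P pi ->
  (forall f, Q f -> P f) -> mspan M Q x -> pi x = x.
Proof.
move=> [pi0 piS] QP; elim=> [//|c f y Qf hy IH].
by rewrite piS ?IH ?QP //; apply: mspan_all hy.
Qed.

Lemma proj_out (P : pred V) (Q : V -> Prop) pi x : is_proj M P pi ->
  (forall f, Q f -> ~~ P f) -> mspan M Q x -> pi x = 0.
Proof.
move=> [pi0 piS] QP; elim=> [//|c f y Qf hy IH].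
by rewrite piS ?IH ?(negPf (QP _ _)) ?addr0 //; apply: mspan_all hy.
Qed.

Lemma proj_span (P : pred V) pi x : is_proj M P pi ->
  mspan M (fun=> True) x -> mspan M P (pi x).
Proof.
move=> [pi0 piS]; elim=> [|c f y _ hy IH]; first by rewrite pi0; apply: mspan0.
rewrite piS //; case: ifP => Pf; last by rewrite add0r.
exact: mspanS.
Qed.

Variables (q : V -> V -> K) (hM : frame M q).

Lemma proj_mulM (P1 P2 : pred V) pi1 pi2 u x :
  is_proj M P1 pi1 -> is_proj M P2 pi2 -> (forall f, P1 (u + f) = P2 f) ->
  mspan M (fun=> True) x -> pi1 (M u * x) = M u * pi2 x.
Proof.
move=> h1 h2 P12; elim=> [|c f y _ hy IH]; first by rewrite h2.1 !mulr0 h1.1.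
rewrite mulrDr -scalerAr (frameM hM) scalerA h1.2; last first.
  by apply: (mspan_allM hM) => //; apply: mspan_mon.
rewrite IH h2.2 // mulrDr P12; case: ifP; rewrite ?mulr0 //.
by rewrite -scalerAr (frameM hM) scalerA.
Qed.

End Projections.

(** Writing T for the torus of [M], this says that right multiplication by [s] kills no nonzero
    class of T modulo p T. *)
Definition regular_mod (M : V -> F) (p s : F) : Prop :=
  forall f g, mspan M (fun=> True) f -> mspan M (fun=> True) g ->
    f * s = p * g -> exists2 g', mspan M (fun=> True) g' & f = p * g'.

Section Regular.
Variables (M : V -> F) (q : V -> V -> K).
Hypotheses (hM : frame M q) (freeM : free_mon M).
Variable w : V -> int.
Hypothesis wD : forall f g, w (f + g) = w f + w g.

Lemma mspan_bounded x : mspan M (fun=> True) x ->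
  exists lo (n : nat), mspan M (fun f => (lo <= w f) && (w f < lo + n%:Z)) x.
Proof.
elim=> [|c f y _ _ [lo [n hy]]]; first by exists 0, 0%N; apply: mspan0.
exists (Num.min lo (w f)), (`|lo|%N + n + `|w f|%N).+1.
by apply: mspanS; [lia | apply: mspan_sub hy => g; lia].
Qed.

(* M u1 + M u2 is w-homogeneous and the top w-component of C *: M k + v is
   invertible, so divisibility descends to the top component of f, which is then
   split off. *)
Lemma regular_top (u1 u2 k : V) (C : K) (v : F) :
  w u1 = w u2 -> C != 0 -> mspan M (fun f => (w f < w k)%R) v ->
  regular_mod M (M u1 + M u2) (C *: M k + v).
Proof.
move=> u12 C0 hv f g hf; have [lo [n]] := mspan_bounded hf.
have [c1 c2] : C *: M k \is a GRing.unit /\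
    (C *: M k)^-1 = C^-1 *: (M k)^-1.
  have Ck : (C *: M k) * (C^-1 *: (M k)^-1) = 1.
    by rewrite -scalerAl -scalerAr scalerA mulfV // scale1r divrr // (frame_unit hM).
  have kC : (C^-1 *: (M k)^-1) * (C *: M k) = 1.
    by rewrite -scalerAl -scalerAr scalerA mulVf // scale1r mulVr // (frame_unit hM).
  have U : C *: M k \is a GRing.unit by apply/unitrP; exists (C^-1 *: (M k)^-1).
  by split=> //; apply: (mulrI U); rewrite Ck divrr.
have hinv : mspan M (fun=> True) (C *: M k)^-1.
  by rewrite c2 -(frameN hM); apply/mspanZ/mspan_mon.
have hv' := mspan_all hv.
have hk : mspan M (fun=> True) (C *: M k) by apply/mspanZ/mspan_mon.
(* Induction on the width [n] of a window of [w]-degrees, with fixed lower end [lo], that contains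
   the support of [f]. *)
elim: n f g {hf} => [|n IH] f g hf hg fg.
  exists 0; first exact: mspan0.
  rewrite mulr0; apply: mspan_none hf => h; lia.
set D := lo + n%:Z.
have [f1 [f0 [ef hf1 hf0]]] := mspan_split (fun h => w h == D) hf.
have {}hf1 : mspan M (fun h => w h == D) f1 by apply: mspan_sub hf1 => h [].
have {}hf0 : mspan M (fun h => (lo <= w h) && (w h < D)) f0.
  by apply: mspan_sub hf0 => h []; rewrite /D; lia.
have Tf1 := mspan_all hf1; have Tf0 := mspan_all hf0.
(* [D + w k] is the highest degree possible in the product on the left. The binomial is homogeneous
   of degree [w u1], so on the right this component comes from the component of [g] of degree
   [D + w k - w u1]. *)
have [pi hpi] := proj_exists (fun h => w h == D + w k) freeM.
have [pi' hpi'] := proj_exists (fun h => w h == D + w k - w u1) freeM.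
have hg' : mspan M (fun=> True) (pi' g) by apply: mspan_all (proj_span hpi' hg).
have top : f1 * (C *: M k) = (M u1 + M u2) * pi' g.
  rewrite mulrDl -(proj_mulM hM hpi hpi' _ hg); last by move=> h; rewrite wD; lia.
  rewrite -(proj_mulM hM hpi hpi' _ hg); last by move=> h; rewrite wD; lia.
  rewrite -(projD hpi) -?mulrDl -?fg; try by apply: (mspan_allM hM) => //; apply: mspan_mon.
  rewrite ef mulrDl [f1 * (_ + v)]mulrDr -addrA (projD hpi).
  - rewrite (proj_in (Q := fun h => w h == D + w k) hpi) //; last first.
      apply: (mspanM hM (Q := fun h => h == k)) hf1 _; last by apply/mspanZ/mspan_mon.
      by move=> h h' /eqP <- /eqP ->; rewrite wD.
    rewrite (proj_out (Q := fun h => (w h < D + w k)%R) hpi) ?addr0 //.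
      by move=> h; lia.
    apply: mspanD.
      by apply: (mspanM hM) hf1 hv => h h'; rewrite wD; lia.
    apply: (mspanM hM (Q := fun h => (w h <= w k)%R)) hf0 _; first by move=> h h'; rewrite wD; lia.
    apply: mspanD; first by apply/mspanZ/mspan_mon.
    by apply: mspan_sub hv => h; lia.
  - exact: (mspan_allM hM).
  - by apply: mspanD; apply: (mspan_allM hM) => //; apply: mspanD.
have f1E : f1 = (M u1 + M u2) * (pi' g * (C *: M k)^-1).
  by rewrite mulrA -top mulrK.
have Tx : mspan M (fun=> True) (pi' g * (C *: M k)^-1) by apply: (mspan_allM hM).
have Ts : mspan M (fun=> True) (C *: M k + v) by apply: mspanD.
case: (IH f0 (g - pi' g * (C *: M k)^-1 * (C *: M k + v)) hf0).
- by apply: mspanB => //; apply: (mspan_allM hM).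
- by rewrite mulrBr -fg !mulrA -[_ * _ * _^-1]mulrA -f1E ef -mulrBl addrAC subrr add0r.
move=> g0 hg0 f0E; exists (pi' g * (C *: M k)^-1 + g0); first exact: mspanD.
by rewrite ef mulrDr -f1E -f0E.
Qed.

End Regular.

Section RegularMore.
Variables (M : V -> F) (q : V -> V -> K).
Hypotheses (hM : frame M q).

Lemma regular_modD p s t : regular_mod M p s -> mspan M (fun=> True) t ->
  (forall x, p * x = x * p) -> regular_mod M p (s + t * p).
Proof.
move=> reg ht pC f g hf hg; rewrite mulrDr => fg.
apply: (reg f (g - f * t)) => //; first by apply: mspanB => //; apply: (mspan_allM hM).
by rewrite mulrBr -fg pC -mulrA addrK.
Qed.

Lemma regular_modM p s t : regular_mod M p s -> regular_mod M p t ->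
  mspan M (fun=> True) s -> regular_mod M p (s * t).
Proof.
move=> rs rt hs f g hf hg; rewrite mulrA => fg.
have [g' hg' e] := rt _ _ (mspan_allM hM hf hs) hg fg.
exact: rs hg' e.
Qed.

Lemma regular_mod1 p : regular_mod M p 1.
Proof. by move=> f g _ hg; rewrite mulr1; exists g. Qed.

Lemma regular_modX p s n : regular_mod M p s -> mspan M (fun=> True) s ->
  regular_mod M p (s ^+ n).
Proof.
move=> rs hs; elim: n => [|n IH]; first exact: regular_mod1.
by rewrite exprS; apply: regular_modM.
Qed.

(** An element with two denominators, a power of [p] and some [s] regular modulo [p], has none: as x
    p^(n+1) s = p (x s p^n), regularity makes x p^(n+1) a multiple of [p], and one factor [p]
    cancels. *)
Lemma regular_cancel p s x n : regular_mod M p s -> mspan M (fun=> True) p ->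
  (forall y, p * y = y * p) ->
  p \is a GRing.unit ->
  mspan M (fun=> True) (x * p ^+ n) -> mspan M (fun=> True) (x * s) ->
  (forall y, s * y = y * s) -> mspan M (fun=> True) x.
Proof.
move=> rs hp pC pU + hxs sC; elim: n => [|n IH]; first by rewrite expr0 mulr1.
rewrite exprSr mulrA => h; apply: IH.
have [||g' hg' e] := rs _ (x * s * p ^+ n) h.
- by apply: (mspan_allM hM) => //; apply: (mspan_allX hM).
- by rewrite pC -!mulrA sC !mulrA.
suff -> : x * p ^+ n = g' by [].
by apply: (mulIr pU); rewrite e pC.
Qed.

End RegularMore.

End Regularity.

(** * Leading terms for orders on the exponents *)

Section LeadingTerms.

Variables (K : fieldType) (F : unitAlgType K) (N : nat).
Local Notation V := 'rV[int]_N.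

(** The positive cone of a total group order on Z^N, in which [g] exceeds [f] when [pos (g - f)]. *)
Definition cone (pos : pred V) : Prop :=
  [/\ forall f g, pos f -> pos g -> pos (f + g), ~~ pos 0
    & forall f, f != 0 -> pos f || pos (- f)].

Definition lexpos : pred V := fun f =>
  [exists i, (0 < f 0 i) && [forall j : 'I_N, (j < i)%N ==> (f 0 j == 0)]].

Lemma lexpos_cone : cone lexpos.
Proof.
split.
- move=> f g /existsP[i /andP[fi /forallP fj]] /existsP[k /andP[gk /forallP gj]].
  apply/existsP; exists (if (i <= k)%N then i else k); apply/andP; split.
    rewrite mxE; case: (ltngtP i k) => ik.
    - by have /implyP /(_ ik) /eqP -> := gj i; rewrite addr0.
    - by have /implyP /(_ ik) /eqP -> := fj k; rewrite add0r.
    - by rewrite (val_inj ik) in fi *; apply: addr_gt0.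
  apply/forallP => j; apply/implyP => lj; rewrite mxE.
  have [ji jk] : (j < i)%N /\ (j < k)%N by move: lj; case: ifP => ? ?; lia.
  by have /implyP /(_ ji) /eqP -> := fj j; have /implyP /(_ jk) /eqP -> := gj j.
- by apply/existsP => -[i]; rewrite mxE ltxx.
- move=> f f0.
  have [i0 fi0] : exists i, f 0 i != 0.
    apply/existsP; apply: contraNT f0; rewrite negb_exists => /forallP h.
    by apply/eqP/rowP => i; rewrite mxE; apply/eqP; rewrite -[_ == _]negbK; apply: h.
  case: (arg_minnP (fun i : 'I_N => i : nat) (P := fun i => f 0 i != 0) fi0) => i fi im.
  have h : forall j : 'I_N, (j < i)%N -> f 0 j = 0.
    by move=> j ji; apply/eqP; apply: contraLR ji => /im; rewrite -leqNgt.
  apply/orP; have [p|p] : 0 < f 0 i \/ f 0 i < 0 by lia.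
  + left; apply/existsP; exists i; rewrite p; apply/forallP => j.
    by apply/implyP => /h ->.
  + right; apply/existsP; exists i; rewrite mxE oppr_gt0 p; apply/forallP => j.
    by apply/implyP => /h; rewrite mxE => ->; rewrite oppr0.
Qed.

Lemma cone_opp pos : cone pos -> cone (fun f => pos (- f)).
Proof.
case=> h1 h2 h3; split; rewrite ?oppr0 //.
  by move=> f g hf hg; rewrite opprD; apply: h1.
by move=> f /h3; rewrite opprK orbC.
Qed.

(** The remainder has only exponents strictly below [g]. The coefficient [c] may vanish here, which
    is why uniqueness asks for nonzero coefficients. *)
Definition lead (M : V -> F) (pos : pred V) x c g : Prop :=
  exists2 y, x = c *: M g + y & mspan M (fun f => pos (g - f)) y.

Section Lead.
Variables (M : V -> F) (q : V -> V -> K) (pos : pred V).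
Hypotheses (hM : frame M q) (freeM : free_mon M) (hpos : cone pos).
Let hq : bichar q. Proof. by case: hM. Qed.

Lemma lead_mon g : lead M pos (M g) 1 g.
Proof. by exists 0; rewrite ?scale1r ?addr0 //; apply: mspan0. Qed.

Lemma leadZ a x c g : lead M pos x c g -> lead M pos (a *: x) (a * c) g.
Proof.
by case=> y -> hy; exists (a *: y); [rewrite scalerDr scalerA | apply: mspanZ].
Qed.

Lemma leadM x y c d g h :
  lead M pos x c g -> lead M pos y d h ->
  lead M pos (x * y) (c * d * q g h) (g + h).
Proof.
case: hpos => posD _ _ [x' -> hx] [y' -> hy].
exists (c *: M g * y' + x' * (d *: M h + y')).
  rewrite mulrDl [c *: M g * (_ + _)]mulrDr -!addrA; congr (_ + _).
  by rewrite -scalerAl -scalerAr (frameM hM) !scalerA.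
apply: mspanD.
  apply: (mspanM hM (P := fun f => f = g)) hy; last by apply/mspanZ/mspan_mon.
  by move=> f f' -> ; rewrite opprD addrACA subrr add0r.
rewrite mulrDr; apply: mspanD.
  apply: (mspanM hM (Q := fun f => f = h)) hx _; last by apply/mspanZ/mspan_mon.
  by move=> f f' hf ->; rewrite opprD addrACA subrr addr0.
apply: (mspanM hM) hx hy => f f' hf hf'.
by rewrite opprD addrACA; apply: posD.
Qed.

Lemma leadX x c g n : q g g = 1 -> lead M pos x c g ->
  lead M pos (x ^+ n) (c ^+ n) (g *+ n).
Proof.
move=> qg hx; elim: n => [|n IH].
  by rewrite !expr0 mulr0n -(frame0 hM); apply: lead_mon.
rewrite !exprS mulrS.
suff {1}-> : c * c ^+ n = c * c ^+ n * q g (g *+ n) by apply: leadM hx IH.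
by rewrite (bicharMnr hq) qg expr1n mulr1.
Qed.

Lemma leadD_gt x y c d g h :
  lead M pos x c g -> lead M pos y d h -> pos (g - h) -> lead M pos (x + y) c g.
Proof.
case: hpos => posD _ _ [x' -> hx] [y' -> hy] gh.
exists (x' + (d *: M h + y')); first by rewrite -addrA.
apply: mspanD => //; apply: mspanS => //; apply: mspan_sub hy => f hf.
by rewrite -(subrK h g) -addrA; apply: posD.
Qed.

Lemma lead_uniq x c d g h : c != 0 -> d != 0 ->
  lead M pos x c g -> lead M pos x d h -> c = d /\ g = h.
Proof.
(* If [g'] exceeds [h'], an expression led by [h'] never reaches the exponent [g']; projecting to
   that exponent would make [c'] zero. *)
have wlog_gt c' d' g' h' : c' != 0 -> pos (g' - h') ->
    lead M pos x c' g' -> lead M pos x d' h' -> False.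
  case: hpos => posD pos0 _ c0 gh [x' e1 hx] [y' e2 hy].
  have [pi hpi] := proj_exists (pred1 g') freeM.
  have := hpi.2 c' g' x' (mspan_all hx); rewrite -e1 e2 (hpi.2 _ _ _ (mspan_all hy)) /=.
  rewrite eqxx; have /negPf -> : h' != g'.
    by apply: contraTneq gh => ->; rewrite subrr.
  have -> : pi x' = 0.
    by apply: (proj_out hpi _ hx) => f hf /=; apply: contraTneq hf => ->; rewrite subrr.
  have -> : pi y' = 0.
    apply: (proj_out hpi _ hy) => f hf /=; apply: contraTneq hf => ->.
    apply/negP => /(posD _ _ gh).
    by rewrite addrA subrK subrr => h0; rewrite h0 in pos0.
  rewrite !addr0 => /esym /eqP; rewrite scaler_eq0 (negPf c0) /=.
  by rewrite (negPf (frame_neq0 hM _)).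
move=> c0 d0 hc hd; case: (eqVneq g h) => [gh|]; last first.
  rewrite -subr_eq0; case: hpos => _ _ /[apply] /orP[|].
    by move=> /wlog_gt /(_ hc hd).
  by rewrite opprB => /wlog_gt /(_ hd hc).
split=> //; rewrite -gh {h gh} in hd.
case: hpos hc hd => _ pos0 _ [x' e1 hx] [y' e2 hy].
have [pi hpi] := proj_exists (pred1 g) freeM.
have := hpi.2 c g x' (mspan_all hx); rewrite -e1 e2 (hpi.2 _ _ _ (mspan_all hy)) /= eqxx.
have -> : pi x' = 0.
  by apply: (proj_out hpi _ hx) => f hf /=; apply: contraTneq hf => ->; rewrite subrr.
have -> : pi y' = 0.
  by apply: (proj_out hpi _ hy) => f hf /=; apply: contraTneq hf => ->; rewrite subrr.
rewrite !addr0 => /esym /eqP; rewrite -subr_eq0 -scalerBl scaler_eq0.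
by rewrite (negPf (frame_neq0 hM _)) orbF subr_eq0 => /eqP.
Qed.

Lemma mspan_seq x : mspan M (fun=> True) x -> exists s : seq V, mspan M (fun f => f \in s) x.
Proof.
elim=> [|c f y _ _ [s hy]]; first by exists [::]; apply: mspan0.
exists (f :: s); apply: mspanS; first by rewrite inE eqxx.
by apply: mspan_sub hy => g; rewrite inE orbC => ->.
Qed.

Lemma mspan1 g x : mspan M (fun f => f = g) x -> exists c, x = c *: M g.
Proof.
elim=> [|c f y -> _ [d ->]]; first by exists 0; rewrite scale0r.
by exists (c + d); rewrite scalerDl.
Qed.

Lemma lead_exists x : mspan M (fun=> True) x -> x <> 0 ->
  exists c g, c != 0 /\ lead M pos x c g.
Proof.
move=> /mspan_seq[s hx] x0.
suff [//|[c [g [c0 _ h]]]] : x = 0 \/ exists c g, [/\ c != 0, g \in s & lead M pos x c g].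
  by exists c, g.
elim: s {x0} x hx => [|f s IH] x hx; first by left; apply: mspan_none hx => f.
have [fs|fs] := boolP (f \in s).
  case: (IH x); first by apply: mspan_sub hx => g; rewrite inE => /orP[/eqP->|].
    by left.
  by move=> [c [g [c0 gs h]]]; right; exists c, g; rewrite inE gs orbT.
have [y [z [-> hy hz]]] := mspan_split (pred1 f) hx.
have [c ->] : exists c, y = c *: M f by apply: mspan1; apply: mspan_sub hy => g [_ /eqP].
have {}hz : mspan M (fun f => f \in s) z.
  by apply: mspan_sub hz => g [] /=; rewrite inE => /orP[->|].
have hf : lead M pos (c *: M f) c f by rewrite -{2}[c]mulr1; apply/leadZ/lead_mon.
case: (IH z hz) => [-> | [d [g [d0 gs hz']]]].
  rewrite addr0; have [-> | c0] := eqVneq c 0; first by left; rewrite scale0r.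
  by right; exists c, f; rewrite inE eqxx.
right; have [-> | c0] := eqVneq c 0.
  by exists d, g; rewrite scale0r add0r inE gs orbT.
have : f - g != 0 by rewrite subr_eq0; apply: contraNneq fs => ->.
case: (hpos) => _ _ /[apply] /orP[gt|].
  by exists c, f; rewrite inE eqxx; split=> //; apply: leadD_gt hz' gt.
rewrite opprB => gt; exists d, g; rewrite inE gs orbT; split=> //.
by rewrite addrC; apply: leadD_gt hf gt.
Qed.

End Lead.
End LeadingTerms.

(** * Consecutive mutations of frames *)

Section MutationOfFrames.

Variables (K : fieldType) (F : unitAlgType K) (N : nat).
Local Notation V := 'rV[int]_N.

Lemma evecE (i j : 'I_N) : (evec i) 0 j = (i == j)%:R.
Proof. by rewrite mxE eqxx /= eq_sym. Qed.

Lemma rv0E (i : 'I_N) : (0 : V) 0 i = 0.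
Proof. by rewrite mxE. Qed.
Lemma rvDE (f g : V) i : (f + g) 0 i = f 0 i + g 0 i.
Proof. by rewrite mxE. Qed.
Lemma rvNE (f : V) i : (- f) 0 i = - f 0 i.
Proof. by rewrite mxE. Qed.
Lemma rvZE a (f : V) i : (a *: f) 0 i = a * f 0 i.
Proof. by rewrite mxE. Qed.
Lemma rvMnE (f : V) n i : (f *+ n) 0 i = f 0 i *+ n.
Proof. by rewrite mulmxnE. Qed.
Definition rvE := (rv0E, rvDE, rvNE, rvZE, rvMnE, evecE).

(* h1 and h2 are the exponents of the two monomials of the exchange relation, so
   that h1 - h2 is the column b^k, and dl is eps^(d_k/2).  The l-th powers of the
   frames of a mutation satisfy the same relation with q = 1 and dl = 1. *)
Definition mut_frame (k : 'I_N) (h1 h2 : V) (dl : K)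
    (M : V -> F) (q : V -> V -> K) (M' : V -> F) (q' : V -> V -> K) : Prop :=
  [/\ frame M q /\ frame M' q',
      h1 0 k = -1 /\ h2 0 k = -1,
      forall f : V, q (h1 - h2) f = dl ^ (f 0 k),
      forall f : V, f 0 k = 0 -> M' f = M f
    & (forall g : V, g 0 k = 0 -> q' (evec k) g = q h1 g) /\
      M' (evec k) = M h1 + M h2].

(** Exchanging the two monomials of the relation allows both signs of an entry of the exchange
    matrix to be treated by the same computation. *)
Lemma mut_frame_sym k h1 h2 dl M q M' q' :
  mut_frame k h1 h2 dl M q M' q' -> mut_frame k h2 h1 dl^-1 M q M' q'.
Proof.
case=> [[hM hM'] [e1 e2] hd hfix [hqk hMk]]; have hq : bichar q by case: hM.
have hd' f : q h1 f = q h2 f * dl ^ (f 0 k) by rewrite -hd -(bicharDl hq) addrC subrK.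
split; [by split | by split | | by [] | ].
- by move=> f; rewrite -opprB (bicharNl hq) hd exprz_inv invr_expz.
- split; last by rewrite addrC.
  by move=> g g0; rewrite hqk // hd' g0 expr0z mulr1.
Qed.

Section Step.
Variables (k : 'I_N) (h1 h2 : V) (dl : K).
Variables (M : V -> F) (q : V -> V -> K) (M' : V -> F) (q' : V -> V -> K).
Hypothesis hmut : mut_frame k h1 h2 dl M q M' q'.
Let hM : frame M q. Proof. by case: hmut => -[]. Qed.
Let hM' : frame M' q'. Proof. by case: hmut => -[]. Qed.
Let hq : bichar q. Proof. by case: hM. Qed.
Let hq' : bichar q'. Proof. by case: hM'. Qed.

Lemma mut_fix (f : V) : f 0 k = 0 -> M' f = M f.
Proof. by case: hmut => _ _ _ h _; apply: h. Qed.

Lemma mut_new : M' (evec k) = M h1 + M h2.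
Proof. by case: hmut => _ _ _ _ []. Qed.

Lemma mut_qnew (g : V) : g 0 k = 0 -> q' (evec k) g = q h1 g.
Proof. by case: hmut => _ _ _ _ [h _]; apply: h. Qed.

Lemma mut_qdiff (f : V) : q (h1 - h2) f = dl ^ (f 0 k).
Proof. by case: hmut => _ _ h _ _; apply: h. Qed.

Lemma mut_free_part (f : V) : (f - f 0 k *: evec k) 0 k = 0.
Proof. by rewrite !rvE ?eqxx /= mulr1 subrr. Qed.

Lemma mut_nonneg (f : V) : 0 <= f 0 k -> mspan M (fun=> True) (M' f).
Proof.
move=> f0; rewrite -(subrK (f 0 k *: evec k) f) (frameD hM').
apply: mspanZ; apply: (mspan_allM hM).
  by rewrite (mut_fix (mut_free_part f)); apply: mspan_mon.
rewrite -[f 0 k]gez0_abs // -natz scaler_nat (frameMn hM') mut_new.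
by apply: (mspan_allX hM); apply: mspanD; apply: mspan_mon.
Qed.

Lemma mut_fix_span x : mspan M' (fun f : V => f 0 k = 0) x -> mspan M (fun f : V => f 0 k = 0) x.
Proof.
elim=> [|c f y f0 _ IH]; first exact: mspan0.
by rewrite mut_fix //; apply: mspanS.
Qed.

Lemma mut_nonneg_span x : mspan M' (fun f : V => 0 <= f 0 k) x -> mspan M (fun=> True) x.
Proof.
elim=> [|c f y f0 _ IH]; first exact: mspan0.
by apply: mspanD => //; apply/mspanZ/mut_nonneg.
Qed.

Lemma mut_pos_div x : mspan M' (fun f : V => 1 <= f 0 k) x ->
  exists2 w, x = w * M' (evec k) & mspan M' (fun f : V => 0 <= f 0 k) w.
Proof.
elim=> [|c f y f0 _ [w -> hw]].
  by exists 0; [rewrite mul0r | apply: mspan0].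
pose e := (q' (f - evec k) (evec k))^-1.
exists ((c * e) *: M' (f - evec k) + w).
  rewrite mulrDl -scalerAl -scalerA [e *: _](_ : _ = M' f) //.
  by rewrite /e -(frameD hM') subrK.
by apply: mspanS => //; rewrite !rvE ?eqxx /=; lia.
Qed.

End Step.

Section TwoSteps.
Variables (i j : 'I_N) (u1 u2 h1 h2 : V) (dl dl' : K).
Variables (M0 M1 M2 : V -> F) (q0 q1 q2 : V -> V -> K).
Hypotheses (ij : i != j).
Hypothesis mut1 : mut_frame i u1 u2 dl M0 q0 M1 q1.
Hypothesis mut2 : mut_frame j h1 h2 dl' M1 q1 M2 q2.
Hypothesis h1i : h1 0 i = 0.
Let hM0 : frame M0 q0. Proof. by case: mut1 => -[]. Qed.
Let hM1 : frame M1 q1. Proof. by case: mut1 => -[]. Qed.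
Let hM2 : frame M2 q2. Proof. by case: mut2 => -[]. Qed.
Let hq0 : bichar q0. Proof. by case: hM0. Qed.
Let hq1 : bichar q1. Proof. by case: hM1. Qed.
Let hq2 : bichar q2. Proof. by case: hM2. Qed.

(** Modulo M1(e_i) the monomial with exponent [h2] disappears from the exchange relation, as it
    contains that variable, and each factor M2(e_j) reduces to M1(h1). The condition [1 <= f 0 i]
    records divisibility by M1(e_i). *)
Lemma mut_power_expand n (g : V) : g 0 i = 0 -> g 0 j = 0 ->
  ((0 < n)%N -> 1 <= h2 0 i) ->
  exists2 R, M2 (evec j *+ n + g) = M1 (h1 *+ n + g) + R
           & mspan M1 (fun f : V => 1 <= f 0 i) R.
Proof.
move=> gi gj; elim: n => [|n IH] h2i.
  exists 0; last exact: mspan0.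
  by rewrite !mulr0n !add0r addr0 (mut_fix mut2).
have [|R eR hR] := IH; first by move=> _; apply: h2i.
have {}h2i : 1 <= h2 0 i by apply: h2i.
rewrite !mulrS -!addrA (frameD hM2) (bicharDr hq2) (bicharMnr hq2) (bichar_diag hq2) expr1n mul1r.
rewrite (mut_qnew mut2) // eR (mut_new mut2) mulrDl [M1 h1 * _]mulrDr.
have e : q1 h1 (h1 *+ n + g) = q1 h1 g.
  by rewrite (bicharDr hq1) (bicharMnr hq1) (bichar_diag hq1) expr1n mul1r.
rewrite {1}(frameM hM1) e -addrA scalerDr scalerA mulVf ?(bichar_neq0 hq1) // scale1r.
eexists; first reflexivity.
apply/mspanZ/mspanD.
  apply: (mspanM hM1 (P := fun f => f = h1)) hR; last exact: mspan_mon.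
  by move=> f f' ->; rewrite !rvE h1i add0r.
apply: (mspanM hM1 (P := fun f => f = h2) (Q := fun f => 0 <= f 0 i)).
- by move=> f f' -> /= hf; rewrite !rvE; lia.
- exact: mspan_mon.
- apply: mspanD; last by apply: mspan_sub hR => f; lia.
  by apply: mspan_mon; rewrite !rvE gi h1i mul0rn addr0.
Qed.

(* M2 v1 + M2 v2 is the variable x_i(t3), and M1 (evec i) is x_i(t1): modulo
   x_i(t1), the variable x_i(t3) is an invertible monomial of degree 1 in x_i(t0)
   plus terms of degree 0.  The monomial C *: M0 k comes from the binomials of the
   exchange relations at t0 and t2, which agree up to a monomial factor. *)
Lemma mut_frame_three n (v1 v2 : V) :
  ((0 < n)%N -> 1 <= h2 0 i) ->
  v1 0 i = -1 -> v2 0 i = -1 -> v1 0 j = n%:Z -> v2 0 j = 0 ->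
  v1 - v2 = u2 - u1 - h1 *+ n + evec j *+ n ->
  (forall f : V, q2 (v1 - v2) f = dl ^ (f 0 i)) ->
  exists C k v w, [/\ M2 v1 + M2 v2 = C *: M0 k + v + w * M1 (evec i),
    C != 0, k 0 i = 1, mspan M0 (fun f : V => f 0 i = 0) v & mspan M0 (fun=> True) w].
Proof.
move=> h2i v1i v2i v1j v2j ev hdl.
(* Multiplying x_i(t3) by x_i(t1) removes the exponent -1 at [i]. The two exponents become
   [evec j *+ n + g] and [Q]; only the first can involve x_j(t2), and [Q] is untouched by both
   mutations. *)
pose g := v1 + evec i - evec j *+ n.
have ji : (j == i) = false by rewrite eq_sym (negPf ij).
have gi : g 0 i = 0 by rewrite /g !rvE eqxx ji v1i /= mul0rn.
have gj : g 0 j = 0.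
  by rewrite /g !rvE v1j !eqxx (negPf ij) /= addr0 -[1 *+ n]/(n%:R) natz subrr.
have [R eR hR] := mut_power_expand gi gj h2i.
have Eg : v1 + evec i = evec j *+ n + g by rewrite /g [RHS]addrC subrK.
pose Q := v2 + evec i; pose P := h1 *+ n + g.
have Qi : Q 0 i = 0 by rewrite /Q !rvE ?eqxx /= v2i.
have Qj : Q 0 j = 0 by rewrite /Q !rvE (negPf ij) v2j.
have Pi : P 0 i = 0 by rewrite /P rvDE gi rvMnE h1i mul0rn.
pose k := Q - u1.
have u1i : u1 0 i = -1 by case: mut1 => _ [].
have ki : k 0 i = 1 by rewrite /k rvDE rvNE Qi u1i.
have ku1 : k + u1 = Q by rewrite /k subrK.
have ku2 : k + u2 = P.
  rewrite /k /P /Q /g; apply/eqP; rewrite -subr_eq0.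
  rewrite (_ : _ - _ = - (v1 - v2) + (u2 - u1 - h1 *+ n + evec j *+ n)).
    by rewrite ev addNr.
  by rewrite !opprD !opprK; apply/rowP=> r; rewrite !rvE; lia.
have [R' eR' hR'] := mut_pos_div mut1 hR.
(* [C] is forced by the coefficient of [M0 Q]. The coefficient of [M0 P] then fits by [eC], because
   both mutations in direction [i] have the same [dl]. *)
pose C := q2 v2 (evec i) / q0 k u1.
have eC : q2 v1 (evec i) = C * q0 k u2.
  have -> : v1 = v1 - v2 + v2 by rewrite subrK.
  rewrite (bicharDl hq2) hdl evecE eqxx expr1z /C.
  have -> : q0 k u2 = q0 k u1 * dl.
    have -> : u2 = u1 - (u1 - u2) by rewrite opprB addrC subrK.
    by rewrite (bicharDr hq0) (bicharNr hq0) -(bicharC hq0) (mut_qdiff mut1) ki expr1z.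
  by rewrite [q0 k u1 * dl]mulrC mulrA mulrAC mulfVK ?(bichar_neq0 hq0) // mulrC.
have [s [t [eR'' hs ht]]] := mspan_split (fun f : V => f 0 i == 0) hR'.
have {}hs : mspan M0 (fun f : V => f 0 i = 0) s.
  by apply: (mut_fix_span mut1); apply: mspan_sub hs => f [_ /eqP].
have [w ew hw] : exists2 w, t = w * M1 (evec i) & mspan M1 (fun f : V => 0 <= f 0 i) w.
  by apply: (mut_pos_div mut1); apply: mspan_sub ht => f []; lia.
exists C, k, (q2 v1 (evec i) *: s), (q2 v1 (evec i) *: w); split=> //.
- apply: (mulIr (frame_unit hM1 (evec i))).
  have -> : (M2 v1 + M2 v2) * M1 (evec i) =
      q2 v1 (evec i) *: (M0 P + R' * M1 (evec i)) + q2 v2 (evec i) *: M0 Q.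
    rewrite -{1}(mut_fix mut2 (f := evec i)) ?evecE ?(negPf ij) //.
    rewrite mulrDl !(frameM hM2) Eg eR -/Q -/P (mut_fix mut2 Qj).
    by rewrite (mut_fix mut1 Qi) (mut_fix mut1 Pi) -eR'.
  have -> : q2 v2 (evec i) = C * q0 k u1 by rewrite /C mulfVK ?(bichar_neq0 hq0).
  rewrite eR'' ew eC !mulrDl -!scalerAl.
  have -> : M0 k * M1 (evec i) = q0 k u1 *: M0 Q + q0 k u2 *: M0 P.
    by rewrite (mut_new mut1) mulrDr !(frameM hM0) ku1 ku2.
  rewrite !scalerDr !scalerA [RHS]addrAC -!addrA [RHS]addrCA; congr (_ + _).
  by rewrite addrCA [RHS]addrCA; congr (_ + _); rewrite addrC.
- by rewrite /C mulf_neq0 ?invr_eq0 ?(bichar_neq0 hq0) ?(bichar_neq0 hq2).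
- exact: mspanZ.
- by apply: mspanZ; apply: (mut_nonneg_span mut1).
Qed.

End TwoSteps.

End MutationOfFrames.

(** * Root of unity toric frames *)

Section ToricFrames.

(** Commutation relations determine only the square of a value of [q]; among l-th roots of unity
    with l odd, the square determines the value. *)
Lemma odd_root1 (K : fieldType) (x : K) n : odd n -> x ^+ 2 = 1 -> x ^+ n = 1 -> x = 1.
Proof.
move=> on x2 xn; rewrite -xn -[n]odd_double_half on -mul2n exprD exprM x2.
by rewrite expr1n mulr1 expr1.
Qed.

Section PrimitiveRoot.
Variables (K : fieldType) (l : nat) (z : K).
Hypotheses (l0 : (0 < l)%N) (zl : l.-primitive_root z).

Lemma prim_neq0 : z != 0.
Proof.
apply: contra_eq_neq (prim_expr_order zl) => ->.
by rewrite expr0n gtn_eqF // eq_sym oner_eq0.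
Qed.

Lemma prim_expz_mod (m : int) : z ^ m = z ^+ `|(m %% l)%Z|%N.
Proof.
have -> : z ^ m = (z ^ l%:Z) ^ (m %/ l%:Z)%Z * z ^ (m %% l%:Z)%Z.
  by rewrite exprz_exp [l%:Z * _]mulrC -expfzDr ?prim_neq0 // -divz_eq.
rewrite -exprnP (prim_expr_order zl) exp1rz mul1r exprnP gez0_abs //.
by rewrite modz_ge0 // -lt0n.
Qed.

Lemma prim_expz_eq (m n : int) : z ^ m = z ^ n <-> (m = n %[mod l%:Z])%Z.
Proof.
have h (k : int) : `|(k %% l)%Z|%:Z = (k %% l)%Z by rewrite gez0_abs // modz_ge0 // -lt0n.
have hl (k : int) : (`|(k %% l)%Z| < l)%N.
  by rewrite -ltz_nat h ltz_pmod // ltz_nat.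
rewrite !prim_expz_mod; split=> [/eqP|->] //.
rewrite (eq_prim_root_expr zl) !modn_small // => /eqP e.
by rewrite -h e h.
Qed.

Lemma prim_expz_order (m : int) : (z ^ m) ^+ l = 1.
Proof. by rewrite exprnP exprzAC -exprnP (prim_expr_order zl) exp1rz. Qed.

End PrimitiveRoot.

Section Bilinear.
Variables (K : fieldType) (N : nat).
Local Notation V := 'rV[int]_N.

Lemma bilDl (lam : 'M[int]_N) (f g h : V) : bil lam (f + g) h = bil lam f h + bil lam g h.
Proof. by rewrite /bil !mulmxDl mxE. Qed.

Lemma bilDr (lam : 'M[int]_N) (f g h : V) : bil lam f (g + h) = bil lam f g + bil lam f h.
Proof. by rewrite /bil linearD mulmxDr mxE. Qed.

Lemma bil_evec (lam : 'M[int]_N) i j : bil lam (evec i) (evec j) = lam i j.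
Proof. by rewrite /bil /evec -rowE trmx_delta -colE !mxE. Qed.

Lemma bil_congr (lam E : 'M[int]_N) (f g : V) :
  bil (E^T *m lam *m E) f g = bil lam (f *m E^T) (g *m E^T).
Proof. by rewrite /bil trmx_mul trmxK !mulmxA. Qed.

Lemma biadd_eq (q r : V -> V -> K) :
  (forall f g, q f g != 0) -> (forall f g, r f g != 0) ->
  (forall f g h, q (f + g) h = q f h * q g h) ->
  (forall f g h, q f (g + h) = q f g * q f h) ->
  (forall f g h, r (f + g) h = r f h * r g h) ->
  (forall f g h, r f (g + h) = r f g * r f h) ->
  (forall i j, q (evec i) (evec j) = r (evec i) (evec j)) ->
  forall f g, q f g = r f g.
Proof.
move=> q0 r0 bicharDl bicharDr rDl rDr e.
have z0 (s : V -> K) : (forall f, s f != 0) -> (forall f g, s (f + g) = s f * s g) -> s 0 = 1.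
  by move=> s0 sD; apply: (mulfI (s0 0)); rewrite -sD addr0 mulr1.
have ext (s t : V -> K) : (forall f, s f != 0) -> (forall f, t f != 0) ->
  (forall f g, s (f + g) = s f * s g) -> (forall f g, t (f + g) = t f * t g) ->
  (forall i, s (evec i) = t (evec i)) -> forall f, s f = t f.
  move=> s0 t0 sD tD st; apply: row_int_ind => [|f i IH|f i IH].
  - by rewrite !z0.
  - by rewrite sD tD IH st.
  - by apply: (mulIf (s0 (evec i))); rewrite -sD subrK st -tD subrK.
move=> f g; move: g; apply: (ext (q f) (r f)) => // i.
by move: f; apply: (ext (q^~ (evec i)) (r^~ (evec i))) => // f h.
Qed.

End Bilinear.

Section FrameExt.
Variables (K : fieldType) (F : unitAlgType K) (N : nat).
Local Notation V := 'rV[int]_N.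

Lemma frame_q_uniq (M : V -> F) q r : frame M q -> frame M r -> forall f g, q f g = r f g.
Proof.
move=> hq hr f g; have := frameM hq f g; rewrite (frameM hr) => /eqP.
rewrite -subr_eq0 -scalerBl scaler_eq0 (negPf (frame_neq0 hq _)) orbF subr_eq0.
by move/eqP.
Qed.

Lemma frame_ext (P : pred 'I_N) (M M' : V -> F) q q' : frame M q -> frame M' q' ->
  (forall i, P i -> M' (evec i) = M (evec i)) ->
  (forall i j, P i -> P j -> q' (evec i) (evec j) = q (evec i) (evec j)) ->
  forall f : V, (forall i, ~~ P i -> f 0 i = 0) -> M' f = M f.
Proof.
move=> hM hM' eM eq f fP.
have hq : bichar q by case: hM. have hq' : bichar q' by case: hM'.
(* The values of the two bicharacters are compared along the way, since adding a basis vector to [f]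
   introduces the factor q(f, e_i). *)
suff : M' f = M f /\ forall i, P i -> q' (evec i) f = q (evec i) f by case.
rewrite [f]row_sum_delta; elim/big_rec: _ => [|i x _ IH].
  by rewrite (frame0 hM) (frame0 hM'); split=> // i; rewrite (bichar0r hq) (bichar0r hq').
have [Pi|/fP ->] := boolP (P i); last by rewrite scale0r add0r.
rewrite addrC -/(evec i).
elim/int_ind: (f 0 i) => [|n [H1 H2]|n [H1 H2]]; first by rewrite scale0r addr0.
- rewrite intS (addrC 1) scalerDl scale1r addrA; split.
    rewrite (frameD hM) (frameD hM') H1 eM // (bicharC hq' (evec i)) H2 //.
    by rewrite (bicharC hq (evec i)).
  by move=> j Pj; rewrite (bicharDr hq) (bicharDr hq') H2 // eq.
- rewrite intS (addrC 1) opprD scalerDl scaleN1r addrA; split.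
    rewrite (frameD hM) (frameD hM') H1 (frameN hM) (frameN hM') eM //.
    rewrite (bicharNr hq) (bicharNr hq') (bicharC hq' (evec i)) H2 //.
    by rewrite (bicharC hq (evec i)).
  by move=> j Pj; rewrite (bicharDr hq) (bicharDr hq') H2 // (bicharNr hq) (bicharNr hq') eq.
Qed.

End FrameExt.

Section Toric.
Variables (K : fieldType) (F : unitAlgType K) (l N : nat) (z : K).
Local Notation V := 'rV[int]_N.
Hypotheses (l0 : (0 < l)%N) (zl : l.-primitive_root z) (oddl : odd l).
Hypothesis charK : [pchar K] =i pred0.
Hypothesis genK : forall x : K, exists p : {poly rat}, x = (map_poly ratr p).[z].

Definition qz (lam : 'M[int]_N) (f g : V) : K := z ^ bil lam f g.

Let z0 : z != 0. Proof. exact: prim_neq0 zl. Qed.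

Lemma qz_evec lam i j : qz lam (evec i) (evec j) = z ^ lam i j.
Proof. by rewrite /qz bil_evec. Qed.

Lemma qz_order lam f g : qz lam f g ^+ l = 1.
Proof. exact: prim_expz_order. Qed.

Lemma qz_neq0 lam f g : qz lam f g != 0.
Proof. exact: expfz_neq0. Qed.

Lemma qzDl lam f g h : qz lam (f + g) h = qz lam f h * qz lam g h.
Proof. by rewrite /qz bilDl expfzDr. Qed.

Lemma qzDr lam f g h : qz lam f (g + h) = qz lam f g * qz lam f h.
Proof. by rewrite /qz bilDr expfzDr. Qed.

Lemma qz_bichar (lam : 'M[int]_N) : (forall i j, (lam i j = - lam j i %[mod (l%:Z)])%Z) <->
  bichar (qz lam).
Proof.
split=> [sk|hq i j]; last first.
  apply/(prim_expz_eq l0 zl); rewrite -invr_expz -!qz_evec.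
  exact: (bicharC hq).
have qC' f g : qz lam f g * qz lam g f = 1.
  apply: (biadd_eq (q := fun f g => qz lam f g * qz lam g f) (r := fun _ _ => 1)).
  - by move=> f' g'; rewrite mulf_neq0 ?qz_neq0.
  - by move=> *; rewrite oner_eq0.
  - by move=> *; rewrite qzDl qzDr mulrACA.
  - by move=> *; rewrite qzDl qzDr mulrACA.
  - by move=> *; rewrite mulr1.
  - by move=> *; rewrite mulr1.
  - move=> i j; have /(prim_expz_eq l0 zl) := sk i j.
    by rewrite !qz_evec => ->; rewrite -invr_expz mulVf ?expfz_neq0.
split=> [|//|f]; first exact: qzDl.
(* Skew-symmetry alone leaves a sign in [q f f]; odd l removes it. *)
by apply: (odd_root1 oddl); rewrite ?qz_order // expr2 qC'.
Qed.

Lemma toric_frameP (M : V -> F) lam : toric_frame l z M lam -> frame M (qz lam).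
Proof. by case=> sk M0 Mm _ _; split=> //; apply/qz_bichar. Qed.

Lemma toric_bichar (M : V -> F) lam : toric_frame l z M lam -> bichar (qz lam).
Proof. by move/toric_frameP => []. Qed.

Lemma natK_neq0 n : (0 < n)%N -> (n%:R : K) != 0.
Proof. by move=> n0; have /pcharf0P -> := charK; rewrite -lt0n. Qed.

Lemma inA_den (x : K) : exists2 n : nat, (0 < n)%N & inA z (n%:R * x).
Proof.
have [p ->] := genK x; exists (\prod_(i < size p) `|denq p`_i|)%N.
  by rewrite prodn_gt0 // => i; rewrite absz_gt0 denq_neq0.
pose D : int := \prod_(i < size p) denq p`_i.
pose c i : int := (D %/ denq p`_i)%Z * numq p`_i.
exists (\poly_(i < size p) c i).
rewrite -[map_poly ratr p]/(\poly_(i < size p) ratr p`_i).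
have -> : map_poly (fun n : int => n%:~R : K) (\poly_(i < size p) c i)
    = \poly_(i < size p) (c i)%:~R.
  apply/polyP => i; rewrite coef_map_id0 ?coef_poly //.
  by case: ifP.
rewrite !horner_poly mulr_sumr; apply: eq_bigr => i _.
rewrite mulrA; congr (_ * _).
have d0 : ((denq p`_i)%:~R : K) != 0.
  rewrite -[denq _]gez0_abs ?denq_ge0 // -pmulrn natK_neq0 //.
  by rewrite absz_gt0 denq_neq0.
have -> : ((\prod_(i < size p) `|denq p`_i|)%N%:R : K) = D%:~R.
  rewrite /D pmulrn; congr (_%:~R).
  rewrite (big_morph Posz PoszM (erefl _)); apply: eq_bigr => j _.
  by rewrite gez0_abs ?denq_ge0.
have dD : (denq p`_i %| D)%Z by rewrite /D (bigD1 i) //= dvdz_mulr.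
by rewrite /ratr /c -{1}(divzK dD) !intrM mulrACA divff // mulr1.
Qed.

(** The definition of a toric frame gives independence over Z[z] only. Finitely many coefficients in
    K = Q(z) have a common integer denominator, which is nonzero in characteristic 0. *)
Lemma toric_free (M : V -> F) lam : toric_frame l z M lam -> free_mon M.
Proof.
case=> _ _ _ ind _ s c us e.
have [n n0 hn] : exists2 n : nat, (0 < n)%N & forall f, f \in s -> inA z (n%:R * c f).
  elim: (s) => [|f t [n n0 hn]]; first by exists 1%N.
  have [m m0 hm] := inA_den (c f); exists (m * n)%N; first by rewrite muln_gt0 m0.
  have inAM (a : nat) x : inA z x -> inA z (a%:R * x).
    case=> p ->; exists (a%:R *: p).
    by rewrite map_polyZ hornerZ /= rmorph_nat.
  move=> g; rewrite inE => /orP[/eqP->|gt].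
    by rewrite mulnC natrM -mulrA; apply: inAM.
  by rewrite natrM -mulrA; apply: inAM; apply: hn.
have nK : (n%:R : K) != 0 by apply: natK_neq0.
have h := ind s (fun f => n%:R * c f) us hn.
move=> f fs; apply: (mulfI nK); rewrite mulr0; apply: h fs.
by under eq_bigr do rewrite -scalerA; rewrite -scaler_sumr e scaler0.
Qed.

End Toric.
End ToricFrames.

(** * Exchange matrices *)

Section ExchangeMatrices.

Section BicharZ.
Variables (K : fieldType) (N : nat) (q : 'rV[int]_N -> 'rV[int]_N -> K).
Hypothesis hq : bichar q.

Lemma bicharZl (a : int) f g : q (a *: f) g = q f g ^ a.
Proof.
elim/int_ind: a => [|n IH|n IH]; first by rewrite scale0r (bichar0l hq) expr0z.
  by rewrite intS scalerDl scale1r (bicharDl hq) IH expfzDr ?(bichar_neq0 hq).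
by rewrite intS opprD scalerDl scaleN1r (bicharDl hq) (bicharNl hq) IH expfzDr ?(bichar_neq0 hq).
Qed.

End BicharZ.

Section Combinatorics.
Variables (N : nat) (ex : {set 'I_N}).
Local Notation V := 'rV[int]_N.
Implicit Types (B : exmat ex) (k j : exT ex).

Definition exch_pos B k : V := - evec (val k) + posp (bcol B k).
Definition exch_neg B k : V := - evec (val k) - negp (bcol B k).

Lemma pospE (b : V) i : posp b 0 i = Num.max 0 (b 0 i).
Proof. by rewrite mxE; case: lerP. Qed.

Lemma negpE (b : V) i : negp b 0 i = Num.min 0 (b 0 i).
Proof. by rewrite mxE oppr_ge0; case: (ltgtP (b 0 i)). Qed.

Lemma bcolE B k i : bcol B k 0 i = B i k.
Proof. by rewrite mxE. Qed.

Lemma exch_posE B k i : exch_pos B k 0 i = - (val k == i)%:R + Num.max 0 (B i k).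
Proof. by rewrite /exch_pos !rvE pospE bcolE. Qed.

Lemma exch_negE B k i : exch_neg B k 0 i = - (val k == i)%:R - Num.min 0 (B i k).
Proof. by rewrite /exch_neg !rvE negpE bcolE. Qed.

Lemma exch_posB B k : exch_pos B k - exch_neg B k = bcol B k.
Proof. apply/rowP => i; rewrite rvDE rvNE exch_posE exch_negE bcolE; lia. Qed.

(** The halved sum is always even, so mutation can be written with positive parts and without
    division; the part of -b_ik that occurs is the one in [mutE]. *)
Lemma mutBE k B i j : i != val k -> j != k ->
  mutB k B i j = B i j + Num.max 0 (- B i k) * B (val k) j
                 + B i k * Num.max 0 (B (val k) j).
Proof.
move=> /negPf ik /negPf jk; rewrite /mutB ik jk /= -addrA; congr (_ + _).
set a := B i k; set b := B (val k) j.
rewrite (_ : `|a| * b + a * `|b| = (Num.max 0 (- a) * b + a * Num.max 0 b) * 2) ?mulzK //.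
by have [a0|a0] := lerP 0 a; have [b0|b0] := lerP 0 b; nia.
Qed.

Lemma mutB_row k B j : mutB k B (val k) j = - B (val k) j.
Proof. by rewrite /mutB eqxx. Qed.

Lemma mutB_col k B i : mutB k B i k = - B i k.
Proof. by rewrite /mutB eqxx orbT. Qed.

Definition skewB B (d : exT ex -> nat) : Prop :=
  (forall j, (0 < d j)%N) /\
  forall i j, (d i)%:Z * B (val i) j = - ((d j)%:Z * B (val j) i).

Section Skew.
Variables (d : exT ex -> nat).

Lemma skewB_diag B k : skewB B d -> B (val k) k = 0.
Proof. by case=> d0 /(_ k k); have := d0 k; nia. Qed.

Lemma exch_pos_k B k : skewB B d -> exch_pos B k 0 (val k) = -1.
Proof. by move=> /skewB_diag h; rewrite exch_posE h eqxx. Qed.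

Lemma exch_neg_k B k : skewB B d -> exch_neg B k 0 (val k) = -1.
Proof. by move=> /skewB_diag h; rewrite exch_negE h eqxx. Qed.

Lemma skewB_mut B k : skewB B d -> skewB (mutB k B) d.
Proof.
move=> [d0 sk]; split=> // i j.
have [->|ik] := eqVneq i k; first by rewrite mutB_row mutB_col !mulrN sk.
have [->|jk] := eqVneq j k; first by rewrite mutB_row mutB_col !mulrN sk.
have vik : val i != val k by apply: contraNneq ik => /val_inj ->.
have vjk : val j != val k by apply: contraNneq jk => /val_inj ->.
rewrite !mutBE //.
have h1 := sk i k; have h2 := sk j k; have h3 := sk i j.
have di := d0 i; have dj := d0 j; have dk := d0 k.
move: (B (val i) k) (B (val j) k) (B (val k) i) (B (val k) j) (B (val i) j) (B (val j) i)
  h1 h2 h3 => a b a' b' c c' h1 h2 h3.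
(* Since the [d] are positive, the skew-symmetry relations pass to positive parts. *)
have m1 : (d i)%:Z * Num.max 0 (- a) = (d k)%:Z * Num.max 0 a' by nia.
have m2 : (d j)%:Z * Num.max 0 (- b) = (d k)%:Z * Num.max 0 b' by nia.
rewrite !mulrDr !mulrA h3 m1 m2 h1 h2.
ring.
Qed.

Lemma mutB_invol B k : skewB B d -> mutB k (mutB k B) = B.
Proof.
move=> hB; apply: functional_extensionality => i; apply: functional_extensionality => j.
have [->|ik] := eqVneq i (val k); first by rewrite !mutB_row opprK.
have [->|jk] := eqVneq j k; first by rewrite !mutB_col opprK.
rewrite mutBE // mutB_row mutB_col mutBE // opprK.
by have [a0|a0] := lerP 0 (B i k); have [b0|b0] := lerP 0 (B (val k) j); nia.
Qed.

Lemma mutE_mul B k (f : V) : skewB B d ->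
  f *m (mutE k B)^T = f + f 0 (val k) *: (exch_neg B k - evec (val k)).
Proof.
move=> hB; apply/rowP => i; rewrite rvDE rvZE rvDE rvNE exch_negE evecE.
have -> : (f *m (mutE k B)^T) 0 i = \sum_j f 0 j * mutE k B i j.
  by rewrite mxE; apply: eq_bigr => j _; rewrite mxE.
rewrite (bigD1 (val k)) //=.
have -> : mutE k B i (val k) = if i == val k then -1 else Num.max 0 (- B i k).
  by rewrite mxE eqxx.
rewrite (eq_bigr (fun j : 'I_N => f 0 j * (i == j)%:R)); last first.
  by move=> j /negPf jk; rewrite mxE jk.
have [->|ik] := eqVneq i (val k).
  rewrite (skewB_diag k hB) big1 ?eqxx /=; last first.
    by move=> j /negPf jk; rewrite eq_sym jk mulr0.
  by rewrite minxx; ring.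
rewrite (bigD1 i) //= eqxx big1; last first.
  by move=> j /andP[_ /negPf ji]; rewrite eq_sym ji mulr0.
have -> : Num.max 0 (- B i k) = - Num.min 0 (B i k) by lia.
by rewrite mulr1; ring.
Qed.

Lemma mutE_free B k (f : V) : skewB B d -> f 0 (val k) = 0 ->
  f *m (mutE k B)^T = f.
Proof. by move=> hB f0; rewrite (mutE_mul k f hB) f0 scale0r addr0. Qed.

Lemma mutE_evec B k : skewB B d -> evec (val k) *m (mutE k B)^T = exch_neg B k.
Proof. by move=> hB; rewrite (mutE_mul k _ hB) evecE eqxx scale1r addrC subrK. Qed.

(** Expressing the new columns, after the change of basis, through the old ones reduces
    compatibility of the mutated pair to that of the original. *)
Lemma mutE_bcol B k j : skewB B d -> j != k ->
  bcol (mutB k B) j *m (mutE k B)^T = bcol B j + Num.max 0 (B (val k) j) *: bcol B k.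
Proof.
move=> hB jk; rewrite (mutE_mul k _ hB); apply/rowP => i.
rewrite rvDE rvZE rvDE rvNE exch_negE [in RHS]rvDE rvZE !bcolE mutB_row evecE.
have [->|ik] := eqVneq i (val k).
  by rewrite mutB_row (skewB_diag k hB) minxx; lia.
rewrite mutBE //; have -> : Num.max 0 (- B i k) = - Num.min 0 (B i k) by lia.
by rewrite /=; ring.
Qed.

End Skew.
End Combinatorics.
End ExchangeMatrices.

(** * Existence of the mutated frame *)

Section MutatedFrame.

Lemma unit_comm_expz (K : fieldType) (F : unitAlgType K) (y m : F) (c : K) (a : int) :
  y \is a GRing.unit -> c != 0 -> y * m = c *: (m * y) -> y ^ a * m = c ^ a *: (m * y ^ a).
Proof.
move=> yU c0 h.
have hX n : y ^+ n * m = c ^+ n *: (m * y ^+ n).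
  elim: n => [|n IH]; first by rewrite !expr0 mul1r mulr1 scale1r.
  by rewrite !exprS -mulrA IH -scalerAr [y * (m * _)]mulrA h -scalerAl scalerA mulrC -mulrA.
case: a => n; first exact: hX.
rewrite !NegzE -!invr_expz -!exprnP.
apply: (mulrI (unitrX n.+1 yU)); rewrite mulrA divrr ?unitrX // mul1r.
rewrite -scalerAr mulrA hX -scalerAl scalerA mulVf ?expf_neq0 // scale1r.
by rewrite mulrK ?unitrX.
Qed.

Lemma proj_sum (K : fieldType) (F : unitAlgType K) (N : nat) (M : 'rV[int]_N -> F)
    (P : pred 'rV[int]_N) pi (I : Type) (s : seq I) (b : pred I) (G : I -> F) :
  is_proj M P pi -> (forall i, mspan M (fun=> True) (G i)) ->
  pi (\sum_(i <- s | b i) G i) = \sum_(i <- s | b i) pi (G i).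
Proof.
move=> hpi hG; have : mspan M (fun=> True) (\sum_(i <- s | b i) G i) /\
  pi (\sum_(i <- s | b i) G i) = \sum_(i <- s | b i) pi (G i).
  elim: s => [|i s [IH1 IH2]]; first by rewrite !big_nil hpi.1; split=> //; apply: mspan0.
  rewrite !big_cons; case: ifP => // _; split; first exact: mspanD.
  by rewrite (projD hpi) ?IH2.
by case.
Qed.

Section Mutation.
Variables (K : fieldType) (F : unitAlgType K) (l N : nat) (z : K).
Variable ex : {set 'I_N}.
Local Notation V := 'rV[int]_N.
Hypotheses (l0 : (0 < l)%N) (zl : l.-primitive_root z) (oddl : odd l).
Hypothesis charK : [pchar K] =i pred0.
Hypothesis genK : forall x : K, exists p : {poly rat}, x = (map_poly ratr p).[z].
Hypothesis Fdiv : forall x : F, x != 0 -> x \is a GRing.unit.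
Variable d : exT ex -> nat.
Implicit Types (M : V -> F) (B : exmat ex) (k j : exT ex) (s : qseed F ex).

Let z0 : z != 0. Proof. exact: prim_neq0 zl. Qed.

(** The multiplicative form of compatibility: pairing with b^j reads off the j-th coordinate of any
    exponent. Later arguments use this form in place of sums of matrix entries. *)
Lemma compatibleP lam B :
  bichar (qz z lam) ->
  compatible l lam B d <-> skewB B d /\
    forall j (f : V), qz z lam (bcol B j) f = (z ^+ d j) ^ f 0 (val j).
Proof.
move=> hq.
have e j i : qz z lam (bcol B j) (evec i) = z ^ (\sum_(k < N) B k j * lam k i).
  rewrite /qz /bil /evec trmx_delta -colE !mxE; congr (_ ^ _).
  by apply: eq_bigr => r _; rewrite mxE.
split=> [[d0 sk h]|[[d0 sk] h]]; last first.
  split=> // i j; apply/(prim_expz_eq l0 zl); rewrite -e h evecE.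
  by case: eqP => _; rewrite ?expr0z ?expr1z.
split=> // j; apply: row_int_ind => [|f i IH|f i IH].
- by rewrite (bichar0r hq) rv0E expr0z.
- rewrite (bicharDr hq) IH e rvDE evecE expfzDr ?expf_neq0 //; congr (_ * _).
  have /(prim_expz_eq l0 zl) -> := h i j.
  by case: eqP => _; rewrite ?expr0z ?expr1z.
- rewrite (bicharDr hq) (bicharNr hq) IH e rvDE rvNE evecE expfzDr ?expf_neq0 //; congr (_ * _).
  rewrite -invr_expz; congr (_^-1).
  have /(prim_expz_eq l0 zl) -> := h i j.
  by case: eqP => _; rewrite ?expr0z ?expr1z.
Qed.

Definition mutL k B (lam : 'M[int]_N) : 'M[int]_N := (mutE k B)^T *m lam *m mutE k B.

Lemma qz_mutL k B lam f g : qz z (mutL k B lam) f g =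
  qz z lam (f *m (mutE k B)^T) (g *m (mutE k B)^T).
Proof. by rewrite /qz bil_congr. Qed.

Lemma mutL_bichar k B lam : bichar (qz z lam) -> bichar (qz z (mutL k B lam)).
Proof.
move=> hq; split=> [f g h|f g|f]; rewrite !qz_mutL.
- by rewrite mulmxDl (bicharDl hq).
- by case: hq.
- exact: (bichar_diag hq).
Qed.

Section OneSeed.
Variables (lam : 'M[int]_N) (B : exmat ex) (k : exT ex).
Hypotheses (hq : bichar (qz z lam)) (hB : skewB B d).
Hypothesis hc : forall j (f : V), qz z lam (bcol B j) f = (z ^+ d j) ^ f 0 (val j).
Let hq' : bichar (qz z (mutL k B lam)). Proof. exact: mutL_bichar. Qed.

Lemma qz_exch_pos (f : V) :
  qz z lam (exch_pos B k) f = qz z lam (exch_neg B k) f * (z ^+ d k) ^ f 0 (val k).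
Proof. by rewrite -hc -exch_posB -(bicharDl hq) addrC subrK. Qed.

Lemma qz_mutL_free (f g : V) : f 0 (val k) = 0 -> g 0 (val k) = 0 ->
  qz z (mutL k B lam) f g = qz z lam f g.
Proof. by move=> f0 g0; rewrite qz_mutL !(mutE_free hB). Qed.

Lemma qz_mutL_new (g : V) : g 0 (val k) = 0 ->
  qz z (mutL k B lam) (evec (val k)) g = qz z lam (exch_pos B k) g.
Proof.
move=> g0; rewrite qz_mutL (mutE_evec k hB) (mutE_free hB) // qz_exch_pos g0.
by rewrite expr0z mulr1.
Qed.

Lemma compatible_mut : compatible l (mutL k B lam) (mutB k B) d.
Proof.
apply/compatibleP => //; split; first exact: skewB_mut.
have hb i : qz z lam (bcol B k) (evec i *m (mutE k B)^T) = (z ^+ d k) ^ (- (val k == i)%:R).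
  rewrite hc; congr (_ ^ _); rewrite (mutE_mul k _ hB) rvDE rvZE rvDE rvNE (exch_neg_k k hB) !evecE.
  by rewrite eqxx eq_sym; case: eqP.
suff h j i : qz z (mutL k B lam) (bcol (mutB k B) j) (evec i) = (z ^+ d j) ^ (val j == i)%:R.
  move=> j; apply: row_int_ind => [|f i IH|f i IH].
  - by rewrite (bichar0r hq') rv0E expr0z.
  - by rewrite (bicharDr hq') IH h rvDE evecE eq_sym expfzDr ?expf_neq0.
  - rewrite (bicharDr hq') (bicharNr hq') IH h rvDE rvNE evecE eq_sym expfzDr ?expf_neq0 //.
    by rewrite invr_expz.
rewrite qz_mutL; have [->|jk] := eqVneq j k.
  have -> : bcol (mutB k B) k = - bcol B k.
    by apply/rowP => r; rewrite rvNE !bcolE mutB_col.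
  rewrite mulNmx [bcol B k *m _](mutE_free hB) ?bcolE ?(skewB_diag k hB) //.
  by rewrite (bicharNl hq) hb invr_expz opprK.
rewrite (mutE_bcol hB jk) (bicharDl hq) (bicharZl hq) hb hc.
rewrite (mutE_mul k _ hB) rvDE rvZE rvDE rvNE exch_negE !evecE.
have [ik|ik] := eqVneq (val k) i; last first.
  by rewrite /= mul0r addr0 oppr0 expr0z exp1rz mulr1 eq_sym.
have /negPf vjk : val j != val k by apply: contraNneq jk => /val_inj ->.
rewrite -ik mul1r eq_sym vjk /= !subr0 add0r oppr0 add0r expr0z.
rewrite exprz_exp mulN1r !exprnP !exprz_exp -expfzDr //.
case: (hB) => d0 sk; have h1 := sk j k; have dj := d0 j; have dk := d0 k.
(* The two contributions d_j max(0, -b_jk) and d_k max(0, b_kj) cancel by skew-symmetry of DB. *)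
rewrite (_ : _ + _ = 0) ?expr0z //.
have [a0|a0] := lerP 0 (B (val j) k); have [b0|b0] := lerP 0 (B (val k) j); nia.
Qed.

End OneSeed.

Section Build.
Variables (M : V -> F) (lam : 'M[int]_N) (B : exmat ex) (k : exT ex).
Hypotheses (tM : toric_frame l z M lam) (hcomp : compatible l lam B d).
Let q := qz z lam.
Let q' := qz z (mutL k B lam).
Let hM : frame M q. Proof. exact: (toric_frameP l0 zl oddl tM). Qed.
Let hq : bichar q. Proof. by case: hM. Qed.
Let hq' : bichar q'. Proof. exact: mutL_bichar. Qed.
Let hB : skewB B d. Proof. by have [/(_ hcomp) []] := compatibleP B hq. Qed.
Let hc j (f : V) : q (bcol B j) f = (z ^+ d j) ^ f 0 (val j).
Proof. by have [/(_ hcomp) [_ h] _] := compatibleP B hq; apply: h. Qed.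
Let freeM : free_mon M. Proof. exact: toric_free genK _ _ tM. Qed.

Local Notation e := (evec (val k)).
Local Notation h1 := (exch_pos B k).
Local Notation h2 := (exch_neg B k).
Let y := M h1 + M h2.

Lemma new_unit : y \is a GRing.unit.
Proof.
(* When the exponents coincide, [y] is twice a monomial and characteristic 0 is used; otherwise
   independence shows that [y] is nonzero. *)
apply: Fdiv; rewrite /y; have [<-|h12] := eqVneq h1 h2.
  rewrite -[M h1]scale1r -scalerDl scaler_eq0 (negPf (frame_neq0 hM _)) orbF.
  by rewrite -(natrD _ 1 1) (natK_neq0 charK).
apply/eqP => H; have := freeM (s := [:: h1; h2]) (c := fun=> 1).
rewrite /= inE h12 => /(_ isT); rewrite !big_cons big_nil !scale1r addr0 H.
by move=> /(_ erefl h1); rewrite !inE eqxx => /(_ isT) /eqP; rewrite oner_eq0.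
Qed.
Let yU := new_unit.

Definition off_dir (f : V) : V := f - f 0 (val k) *: e.

Lemma off_dir_k f : off_dir f 0 (val k) = 0.
Proof. by rewrite /off_dir !rvE eqxx mulr1 subrr. Qed.

Lemma off_dirD (f g : V) : off_dir (f + g) = off_dir f + off_dir g.
Proof. by rewrite /off_dir rvDE scalerDl opprD addrACA. Qed.

Lemma off_dir_id (f : V) : f 0 (val k) = 0 -> off_dir f = f.
Proof. by rewrite /off_dir => ->; rewrite scale0r subr0. Qed.

(** This value is forced: the new frame agrees with [M] away from direction [k], sends e_k to [y],
    and [q'] fixes the scalar between a monomial and the ordered product of its two parts. *)
Definition mutM (f : V) : F :=
  (q' (off_dir f) (f 0 (val k) *: e))^-1 *: (M (off_dir f) * y ^ f 0 (val k)).

(** The two monomials of [y] differ by b^k, which pairs trivially with every [g] having zero k-th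
    coordinate; hence both commute with [M g] up to the same scalar. *)
Lemma new_comm (a : int) (g : V) : g 0 (val k) = 0 ->
  y ^ a * M g = (q' e g ^+ 2) ^ a *: (M g * y ^ a).
Proof.
move=> g0; apply: unit_comm_expz => //; first by rewrite expf_neq0 // (bichar_neq0 hq').
rewrite mulrDl mulrDr !(frame_comm hM _ g) scalerDr; congr (_ + _); congr (_ ^+ 2 *: _).
  by rewrite /q' (qz_mutL_new hq hB hc).
by rewrite /q' (qz_mutL_new hq hB hc) // (qz_exch_pos k hq hc) g0 expr0z mulr1.
Qed.

Lemma mutM_frame : frame mutM q'.
Proof.
split=> //.
  rewrite /mutM rv0E off_dir_id ?rv0E // (frame0 hM) scale0r (bichar0l hq') expr0z mulr1.
  by rewrite invr1 scale1r.
have key (u v : V) (a b : int) : v 0 (val k) = 0 ->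
    M u * y ^ a * (M v * y ^ b) = ((q' e v ^+ 2) ^ a * q u v) *: (M (u + v) * y ^ (a + b)).
  move=> v0; rewrite mulrA -[M u * _ * M v]mulrA new_comm // -scalerAr -!scalerAl -scalerA.
  by rewrite (mulrA (M u)) (frameM hM) exprzDr // -!scalerAl mulrA.
move=> f g; rewrite /mutM -scalerAl -scalerAr !scalerA key ?off_dir_k // scalerA.
rewrite -rvDE -off_dirD; congr (_ *: _).
have -> : q (off_dir f) (off_dir g) = q' (off_dir f) (off_dir g).
  by rewrite /q' (qz_mutL_free lam hB) // off_dir_k.
have alg (u v : V) (a b : int) :
    (q' u (a *: e))^-1 / q' v (b *: e) * ((q' e v ^+ 2) ^ a * q' u v)
    = q' (u + a *: e) (v + b *: e) / q' (u + v) ((a + b) *: e).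
  rewrite scalerDl !(bicharDl hq', bicharDr hq').
  have -> : q' (a *: e) (b *: e) = 1.
    by rewrite (bicharZl hq') (bicharC hq') (bicharZl hq') (bichar_diag hq') exp1rz invr1 exp1rz.
  have -> : q' (a *: e) v = q' e v ^ a by rewrite (bicharZl hq').
  have -> : q' v (a *: e) = (q' e v ^ a)^-1 by rewrite (bicharC hq' (a *: e)) (bicharZl hq').
  have -> : (q' e v ^+ 2) ^ a = (q' e v ^ a) ^+ 2 by rewrite !exprnP exprzAC.
  have x0 : q' e v ^ a != 0 by rewrite expfz_neq0 ?(bichar_neq0 hq').
  have w1 := bichar_neq0 hq' u (a *: e); have w2 := bichar_neq0 hq' u (b *: e).
  have w3 := bichar_neq0 hq' v (b *: e).
  move: (q' e v ^ a) (q' u v) (q' u (a *: e)) (q' u (b *: e)) (q' v (b *: e)) x0 w1 w2 w3.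
  by move=> x A1 A2 A3 A4 x0 w1 w2 w3; field; rewrite w1 w2 w3 x0.
rewrite alg /off_dir !subrK.
by rewrite -/(off_dir f) -/(off_dir g) -/(off_dir (f + g)) off_dirD rvDE.
Qed.

Lemma mutM_fix (f : V) : f 0 (val k) = 0 -> mutM f = M f.
Proof.
by move=> f0; rewrite /mutM off_dir_id // f0 scale0r (bichar0r hq') expr0z invr1 scale1r mulr1.
Qed.

Lemma mutM_new : mutM e = y.
Proof.
rewrite /mutM evecE eqxx expr1z /off_dir evecE eqxx scale1r subrr (frame0 hM) mul1r.
by rewrite (bichar0l hq') invr1 scale1r.
Qed.

(* After right multiplication by a power of y, every mutM f becomes a Laurent
   polynomial that is homogeneous in the k-th exponent; separate these degrees. *)
Lemma mutM_free : free_mon mutM.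
Proof.
move=> s c us sum0 f0 f0s; pose a : int := (f0 : V) 0 (val k).
pose kk (f : V) : int := f 0 (val k).
(* Large enough to make every exponent f_k + n of [y] nonnegative. *)
pose n := (\sum_(f <- s) `|kk f|)%N.
have hn (f : V) : f \in s -> exists m : nat, kk f + n%:Z = m%:Z.
  move=> fs; exists (absz (kk f + n%:Z)).
  have : (`|kk f| <= n)%N by rewrite /n (big_rem f) //= leq_addr.
  by lia.
have yspan m : mspan M (fun h : V => h 0 (val k) = - m%:Z) (y ^+ m).
  elim: m => [|m IH].
    by rewrite expr0 -(frame0 hM); apply: mspan_mon; rewrite rv0E oppr0.
  rewrite exprS; apply: (mspanM hM (P := fun h : V => h 0 (val k) = -1)) IH.
    by move=> f g /= fk gk; rewrite rvDE; lia.
  by apply: mspanD; apply: mspan_mon; rewrite ?(exch_pos_k k hB) ?(exch_neg_k k hB).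
pose t (f : V) := (c f * (q' (off_dir f) (f 0 (val k) *: e))^-1).
pose G (f : V) := t f *: (M (off_dir f) * y ^+ absz (kk f + n%:Z)).
have Gs (f : V) (m : nat) : kk f + n%:Z = m%:Z -> mspan M (fun h : V => h 0 (val k) = - m%:Z) (G f).
  move=> fm; rewrite /G fm; apply: mspanZ.
  apply: (mspanM hM (P := fun h : V => h 0 (val k) = 0)) (yspan m).
    by move=> u v /= uk vk; rewrite rvDE; lia.
  by apply: mspan_mon; apply: off_dir_k.
have sumG : \sum_(f <- s) G f = 0.
  rewrite -[RHS](mul0r (y ^+ n)) -[in RHS]sum0 mulr_suml.
  apply: eq_big_seq => f fs; have [m fm] := hn f fs.
  rewrite /G /t /mutM -scalerA -!scalerAl -mulrA; congr (_ *: (_ *: (_ * _))).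
  by rewrite [y ^+ n]exprnP -exprzDr // fm.
have [m0 fm0] := hn _ f0s.
have [pi hpi] := proj_exists (fun h : V => h 0 (val k) == - m0%:Z) freeM.
have GT f : mspan M (fun=> True) (G f).
  apply: mspanZ; apply: (mspan_allM hM); first exact: mspan_mon.
  exact: mspan_all (yspan _).
have := proj_sum s xpredT hpi GT; rewrite sumG hpi.1.
rewrite (bigID (fun f : V => f 0 (val k) == a)) /= [X in _ + X]big1_seq ?addr0; last first.
  move=> f /andP[fa fs]; have [m fm] := hn f fs.
  by apply: (proj_out hpi) (Gs f m fm) => h /= ->; have : kk f != kk f0 by []; lia.
rewrite -big_filter; set s' := [seq f <- s | _].
have s'P (f : V) : f \in s' -> f 0 (val k) = a /\ f \in s.
  by rewrite mem_filter => /andP[/eqP].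
rewrite (eq_big_seq (fun f => t f *: M (off_dir f) * y ^+ m0)); last first.
  move=> f /s'P[fa fs]; have fm : kk f + n%:Z = m0%:Z by rewrite /kk fa.
  rewrite (proj_in hpi _ (Gs f m0 fm)); first by rewrite /G fm /= -scalerAl.
  by move=> h ->.
rewrite -mulr_suml => /esym /(canRL (mulrK (unitrX m0 yU))); rewrite mul0r => sum1.
(* All remaining [f] have k-th coordinate [a], so right multiplication by [M (a *: e)] restores
   [M f] from its part off direction [k], up to a nonzero scalar. *)
pose r f := t f * q (off_dir f) (a *: e).
have sum2 : \sum_(f <- s') r f *: M f = 0.
  rewrite -[RHS](mul0r (M (a *: e))) -[in RHS]sum1 mulr_suml.
  apply: eq_big_seq => f /s'P[fa fs].
  by rewrite -scalerAl (frameM hM) scalerA /r -fa /off_dir subrK.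
have us' : uniq s' by rewrite filter_uniq.
have f0s' : f0 \in s' by rewrite mem_filter eqxx.
have := freeM us' sum2 f0s'; rewrite /r /t => /eqP.
rewrite !mulf_eq0 invr_eq0 (negPf (bichar_neq0 hq' _ _)) (negPf (bichar_neq0 hq _ _)) !orbF.
by move/eqP.
Qed.

Lemma mutM_gen (S : F -> Prop) : (forall f, S (mutM f)) -> S (z%:A) ->
  (forall x y, S x -> S y -> S (x - y)) -> (forall x y, S x -> S y -> S (x * y)) ->
  (forall x, S x -> S x^-1) -> forall x, S x.
Proof.
move=> SM Sz SB SM' SV.
have S1 : S 1 by rewrite -(frame0 mutM_frame).
have S0 : S 0 by rewrite -(subrr 1); apply: SB.
have SD u v : S u -> S v -> S (u + v).
  by move=> Su Sv; rewrite -[v]opprK; apply: (SB) => //; rewrite -sub0r; apply: (SB).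
have Szn (m : int) : S ((z ^ m)%:A).
  rewrite (prim_expz_mod l0 zl).
  elim: `|_|%N => [|n IH]; first by rewrite expr0 scale1r.
  by rewrite exprS -scalerA -mulr_algl; apply: SM'.
have SZ m x : S x -> S (z ^ m *: x) by move=> Sx; rewrite -mulr_algl; apply: SM'.
have Sfree (g : V) : g 0 (val k) = 0 -> S (M g) by move=> g0; rewrite -mutM_fix.
have Sy : S y by rewrite -mutM_new.
(* The old variable is recovered from the exchange relation: [M e * y] involves only monomials with
   zero k-th exponent, on which the two frames agree. *)
have Se : S (M e).
  rewrite -[M e](mulrK yU); apply: SM'; last exact: SV.
  rewrite /y mulrDr !(frameM hM); apply: SD; apply: SZ; apply: Sfree.
    by rewrite rvDE evecE eqxx (exch_pos_k k hB).
  by rewrite rvDE evecE eqxx (exch_neg_k k hB).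
have Sei i : S (M (evec i)).
  have [->|ik] := eqVneq i (val k); first exact: Se.
  by apply: Sfree; rewrite evecE (negPf ik).
case: tM => _ _ _ _ gen; apply: gen => // ; apply: row_int_ind => [|f i IH|f i IH].
- by rewrite (frame0 hM).
- by rewrite (frameD hM) /q /qz invr_expz; apply/SZ/SM'.
- rewrite (frameD hM) /q /qz invr_expz; apply/SZ/SM' => //.
  by rewrite (frameN hM); apply: SV.
Qed.

Lemma mutM_toric : toric_frame l z mutM (mutL k B lam).
Proof.
split.
- by apply/(qz_bichar l0 zl oddl).
- exact: (frame0 mutM_frame).
- exact: (frameM mutM_frame).
- by move=> s c us _; apply: mutM_free.
- exact: mutM_gen.
Qed.

End Build.
End Mutation.
End MutatedFrame.

(** * Seeds and their l-th powers *)

Section QuantumPower.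

(* (A (1 + C))^n = A^n (1 + C) (1 + w^-1 C) ... (1 + w^-(n-1) C), and the last
   product is 1 + C^l for n = l odd. *)
Lemma qpower_sum (K : fieldType) (F : unitAlgType K) (l : nat) (w : K) (A C : F) :
  (0 < l)%N -> l.-primitive_root w -> odd l ->
  A * C = w *: (C * A) -> (A + A * C) ^+ l = A ^+ l * (1 + C ^+ l).
Proof.
move=> l0 wl oddl AC.
have w0 : w != 0 by apply: (prim_neq0 l0 wl).
have CA n : C * A ^+ n = w^-1 ^+ n *: (A ^+ n * C).
  elim: n => [|n IH]; first by rewrite !expr0 mulr1 mul1r scale1r.
  have CA1 : C * A = w^-1 *: (A * C) by rewrite AC scalerA mulVf ?scale1r.
  by rewrite !exprS mulrA CA1 -scalerAl -(mulrA A C) IH -scalerAr scalerA mulrA.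
pose p n : {poly K} := \prod_(0 <= i < n) (1 + w^-1 ^+ i *: 'X).
have pow n : (A + A * C) ^+ n = A ^+ n * horner_alg C (p n).
  elim: n => [|n IH]; first by rewrite /p big_geq // rmorph1 mulr1.
  have step : (A + A * C) * A ^+ n = A ^+ n.+1 * (1 + w^-1 ^+ n *: C).
    rewrite mulrDl -(mulrA A C) CA -exprS mulrDr mulr1 exprS -!scalerAr mulrA.
    by [].
  have -> : p n.+1 = (1 + w^-1 ^+ n *: 'X) * p n by rewrite /p big_nat_recr //= mulrC.
  rewrite exprS IH mulrA step -mulrA.
  by rewrite rmorphM rmorphD rmorph1 /= linearZ /= horner_algX mulr_algl.
(* The factorization of X^l - 1 over the powers of [w], evaluated at -X and at 0; odd l makes the
   signs agree. *)
have pE : p l = 1 + 'X^l.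
  have prodw : \prod_(0 <= i < l) - w ^+ i = -1.
    have := congr1 (horner^~ 0) (factor_Xn_sub_1 wl).
    rewrite horner_prod !hornerE expr0n gtn_eqF // add0r => <-.
    by apply: eq_bigr => i _; rewrite !hornerE ?add0r.
  have prodX : \prod_(0 <= i < l) (- 'X - (w ^+ i)%:P) = - (1 + 'X^l) :> {poly K}.
    have := congr1 (fun r => r \Po (- 'X)) (factor_Xn_sub_1 wl).
    rewrite rmorph_prod /= comp_polyB comp_Xn_poly exprNn -signr_odd oddl expr1 mulN1r.
    rewrite comp_polyC opprD addrC => <-.
    by apply: eq_bigr => i _; rewrite comp_polyB comp_polyX comp_polyC.
  transitivity ((\prod_(0 <= i < l) (- w ^+ i)^-1)%:P * \prod_(0 <= i < l) (- 'X - (w ^+ i)%:P)).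
    rewrite rmorph_prod -big_split; apply: eq_bigr => i _ /=.
    rewrite -opprD invrN polyCN mulrNN mulrDr -polyCM mulVf ?expf_neq0 //.
    by rewrite mul_polyC exprVn addrC.
  by rewrite prodfV prodw invrN invr1 polyCN polyC1 prodX mulN1r opprK.
by rewrite pow pE rmorphD rmorph1 rmorphXn /= horner_algX.
Qed.

End QuantumPower.

Section Seeds.

Variables (K : fieldType) (F : unitAlgType K) (l N : nat) (z : K).
Variable ex : {set 'I_N}.
Local Notation V := 'rV[int]_N.
Hypotheses (l0 : (0 < l)%N) (zl : l.-primitive_root z) (oddl : odd l).
Hypothesis charK : [pchar K] =i pred0.
Hypothesis genK : forall x : K, exists p : {poly rat}, x = (map_poly ratr p).[z].
Hypothesis Fdiv : forall x : F, x != 0 -> x \is a GRing.unit.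
Variable d : exT ex -> nat.
Implicit Types (M : V -> F) (B : exmat ex) (k j : exT ex) (s : qseed F ex).

Let z0 : z != 0. Proof. exact: prim_neq0 zl. Qed.

Lemma toric_congr M lam lam' : toric_frame l z M lam ->
  (forall f g, qz z lam' f g = qz z lam f g) -> toric_frame l z M lam'.
Proof.
move=> tM e; have := toric_bichar l0 zl oddl tM => hq.
case: tM => sk M0 Mm ind gen; split=> //.
  apply/(qz_bichar l0 zl oddl); case: hq => h1 h2 h3.
  by split=> *; rewrite !e.
by move=> f g; rewrite Mm -/(qz z lam f g) -e.
Qed.

(** The form is not part of the data to be compared: the commutation of the variables gives the
    squares of the values of [q], and l is odd. *)
Lemma toric_ext M M' lam lam' : toric_frame l z M lam -> toric_frame l z M' lam' ->
  (forall i, M' (evec i) = M (evec i)) -> M' = M.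
Proof.
move=> tM tM' e; have hM := toric_frameP l0 zl oddl tM; have hM' := toric_frameP l0 zl oddl tM'.
apply: functional_extensionality => f.
apply: (frame_ext (P := xpredT) hM hM') => // i j _ _.
have hq : bichar (qz z lam) by case: hM. have hq' : bichar (qz z lam') by case: hM'.
have := frame_comm hM' (evec i) (evec j); rewrite !e (frame_comm hM) => /eqP.
rewrite -subr_eq0 -scalerBl scaler_eq0 (frameM hM) scaler_eq0 (negPf (frame_neq0 hM _)).
rewrite (negPf (bichar_neq0 hq _ _)) !orbF subr_eq0 => /eqP e2.
apply: (mulfI (invr_neq0 (bichar_neq0 hq (evec i) (evec j)))); rewrite mulVf ?(bichar_neq0 hq) //.
apply: (odd_root1 oddl); first by rewrite exprMn exprVn e2 mulVf // expf_neq0 ?(bichar_neq0 hq').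
by rewrite exprMn exprVn !(qz_order zl) ?invr1 ?mulr1.
Qed.

(** The witness [d] is fixed, whereas [is_qseed] quantifies over it; coprimality of l and [d] thus
    holds at every seed of a path. *)
Definition good s : Prop :=
  exists lam, toric_frame l z s.1 lam /\ compatible l lam s.2 d.

Lemma compatible_congr lam lam' B : bichar (qz z lam) ->
  (forall f g, qz z lam' f g = qz z lam f g) -> compatible l lam B d -> compatible l lam' B d.
Proof.
move=> hq e; have hq' : bichar (qz z lam').
  by case: hq => h1 h2 h3; split=> *; rewrite !e.
move=> /(compatibleP l0 zl _ _ hq) [hB hc]; apply/(compatibleP l0 zl _ _ hq').
by split=> // j f; rewrite e.
Qed.

Lemma qmut_exists k s : good s -> exists s', qmut l z k s s'.
Proof.
case: s => M B [lam [/= tM hc]]; exists (mutM z M lam B k, mutB k B); split=> //=.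
exists lam; split=> //; split; first exact: (mutM_toric l0 zl oddl charK genK Fdiv k tM hc).
split; last exact: (mutM_new l0 zl oddl _ _ tM).
move=> j jk; apply: (mutM_fix l0 zl oddl _ tM).
by rewrite evecE (negPf jk).
Qed.

Definition mutation_data k s s' lam : Prop :=
  [/\ toric_frame l z s.1 lam /\ compatible l lam s.2 d,
      toric_frame l z s'.1 (mutL k s.2 lam) /\ compatible l (mutL k s.2 lam) s'.2 d,
      s'.2 = mutB k s.2
    & mut_frame (val k) (exch_pos s.2 k) (exch_neg s.2 k) (z ^+ d k)
        s.1 (qz z lam) s'.1 (qz z (mutL k s.2 lam))].

Lemma qmut_data k s s' : good s -> qmut l z k s s' -> exists lam, mutation_data k s s' lam.
Proof.
case=> lam0 [tM0 hc0] [eB [lam [tM [tM' [eM ek]]]]].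
have hM := toric_frameP l0 zl oddl tM; have hM' := toric_frameP l0 zl oddl tM'.
have hM0 := toric_frameP l0 zl oddl tM0.
have hq : bichar (qz z lam) by case: hM.
have hq0 : bichar (qz z lam0) by case: hM0.
(* [qmut] may come with another integer matrix for the form; both give the same bicharacter, on
   which alone compatibility depends. *)
have hc : compatible l lam s.2 d.
  by apply: (compatible_congr hq0) hc0 => f g; apply: frame_q_uniq hM hM0 f g.
have [hB hcq] : skewB s.2 d /\ forall j (f : V),
    qz z lam (bcol s.2 j) f = (z ^+ d j) ^ f 0 (val j).
  by apply/(compatibleP l0 zl).
exists lam; split=> //; first by rewrite eB; split=> //; apply: (compatible_mut l0 zl oddl).
split=> //.
- by split; [apply: (exch_pos_k k hB) | apply: (exch_neg_k k hB)].
- by move=> f; rewrite exch_posB hcq.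
- move=> f f0; apply: (frame_ext (P := fun i => i != val k) hM hM') => //.
    move=> i j ik jk; apply: (qz_mutL_free _ _ hB).
      by rewrite evecE (negPf ik).
    by rewrite evecE (negPf jk).
  by move=> i; rewrite negbK => /eqP ->.
- by split=> // g g0; apply: (qz_mutL_new hq hB hcq).
Qed.

Lemma qmut_good k s s' : good s -> qmut l z k s s' -> good s'.
Proof.
by move=> gs /(qmut_data gs)[lam [_ [t c] _ _]]; exists (mutL k s.2 lam).
Qed.

Lemma qmut_det k s s1 s2 : good s -> qmut l z k s s1 -> qmut l z k s s2 -> s1 = s2.
Proof.
move=> gs m1 m2; have [lam1 [_ [t1 _] e1 f1]] := qmut_data gs m1.
have [lam2 [_ [t2 _] e2 f2]] := qmut_data gs m2.
rewrite (surjective_pairing s1) (surjective_pairing s2) e1 e2; congr (_, _).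
apply: (toric_ext t2 t1) => i; have [->|ik] := eqVneq i (val k).
  by rewrite (mut_new f1) (mut_new f2).
by rewrite (mut_fix f1) ?(mut_fix f2) // evecE (negPf ik).
Qed.

Lemma exch_pos_mutB B k : exch_pos (mutB k B) k = exch_neg B k.
Proof. by apply/rowP => i; rewrite exch_posE exch_negE mutB_col; lia. Qed.

Lemma exch_neg_mutB B k : exch_neg (mutB k B) k = exch_pos B k.
Proof. by apply/rowP => i; rewrite exch_posE exch_negE mutB_col; lia. Qed.

Lemma qmut_sym k s s' : good s -> qmut l z k s s' -> qmut l z k s' s.
Proof.
move=> gs m; have [lam [[t c] [t' c'] eB f]] := qmut_data gs m.
have hM := toric_frameP l0 zl oddl t; have hM' := toric_frameP l0 zl oddl t'.
have hq : bichar (qz z lam) by case: hM.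
have hq' : bichar (qz z (mutL k s.2 lam)) by case: hM'.
have [hB hc] : skewB s.2 d /\ forall j (f : V),
    qz z lam (bcol s.2 j) f = (z ^+ d j) ^ f 0 (val j).
  by apply/(compatibleP l0 zl).
have hB' : skewB (mutB k s.2) d by apply: skewB_mut.
split; first by rewrite eB (mutB_invol k hB).
set e := evec (val k).
(* The composite of the two changes of basis is not the identity but sends e_k to e_k + b^k. It
   preserves the form because b^k pairs trivially with the other basis vectors. *)
have X : e *m (mutE k (mutB k s.2))^T *m (mutE k s.2)^T = e + bcol s.2 k.
  rewrite (mutE_evec k hB') exch_neg_mutB (mutE_mul k _ hB) (exch_pos_k k hB) scaleN1r.
  by rewrite opprB addrCA -/e; congr (_ + _); apply: exch_posB.
have X0 i : i != val k -> evec i *m (mutE k (mutB k s.2))^T *m (mutE k s.2)^T = evec i.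
  by move=> ik; rewrite (mutE_free hB') ?(mutE_free hB) // evecE (negPf ik).
exists (mutL k s.2 lam); split=> //; split.
  apply: (toric_congr t) => f1 g1; rewrite eB; apply: biadd_eq f1 g1.
  - by move=> *; apply: (bichar_neq0 (mutL_bichar _ _ hq')).
  - by move=> *; apply: (bichar_neq0 hq).
  - exact: (bicharDl (mutL_bichar _ _ hq')).
  - exact: (bicharDr (mutL_bichar _ _ hq')).
  - exact: (bicharDl hq).
  - exact: (bicharDr hq).
  move=> i j; rewrite !qz_mutL.
  have [->|ik] := eqVneq i (val k); have [->|jk] := eqVneq j (val k).
  - by rewrite !(bichar_diag hq).
  - rewrite X X0 // (bicharDl hq) hc evecE (negPf jk) expr0z mulr1 //.
  - rewrite X X0 // (bicharDr hq) (bicharC hq (bcol s.2 k)) hc evecE (negPf ik) expr0z invr1 mulr1 //.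
  - by rewrite !X0.
split; first by move=> j jk; rewrite (mut_fix f) // evecE (negPf jk).
rewrite eB -[_ + posp _]/(exch_pos (mutB k s.2) k) -[_ - negp _]/(exch_neg (mutB k s.2) k).
rewrite exch_pos_mutB exch_neg_mutB -/e.
have k1 : (e + exch_pos s.2 k) 0 (val k) = 0 by rewrite rvDE (exch_pos_k k hB) evecE eqxx.
have k2 : (e + exch_neg s.2 k) 0 (val k) = 0 by rewrite rvDE (exch_neg_k k hB) evecE eqxx.
apply: (mulrI (frame_unit hM' e)); rewrite mulrDr !(frameM hM') (mut_fix f k1) (mut_fix f k2).
rewrite (mut_new f) mulrDl !(frameM hM) !(addrC _ e) [RHS]addrC.
have e1 : qz z (mutL k s.2 lam) e (exch_neg s.2 k) = qz z lam (exch_neg s.2 k) e.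
  rewrite qz_mutL (mutE_evec k hB) (mutE_mul k _ hB) (exch_neg_k k hB) scaleN1r opprB.
  by rewrite addrC subrK.
have e2 : qz z (mutL k s.2 lam) e (exch_pos s.2 k) = qz z lam (exch_pos s.2 k) e.
  rewrite qz_mutL (mutE_evec k hB) (mutE_mul k _ hB) (exch_pos_k k hB) scaleN1r opprB.
  rewrite addrCA exch_posB (qz_exch_pos k hq hc) evecE eqxx (bicharDr hq); congr (_ * _).
  by rewrite (bicharC hq (bcol _ _)) hc (exch_neg_k k hB) invr_expz opprK.
by rewrite e1 e2.
Qed.

Definition powM M : V -> F := fun f => M (f *+ l).

Lemma qz_mull (lam : 'M[int]_N) (f g : V) : bichar (qz z lam) -> qz z lam (f *+ l) g = 1.
Proof. by move=> hq; rewrite (bicharMnl hq) (qz_order zl). Qed.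

Lemma powM_frame M lam : toric_frame l z M lam -> frame (powM M) (fun _ _ => 1).
Proof.
move=> /(toric_frameP l0 zl oddl) hM; have hq : bichar (qz z lam) by case: hM.
split; first by split=> *; rewrite ?mulr1.
  by rewrite /powM mul0rn (frame0 hM).
by move=> f g; rewrite /powM (frameM hM) (qz_mull _ _ hq) mulrnDl.
Qed.

Hypothesis copd : forall k, coprime l (d k).

Lemma powM_mut k s s' lam : mutation_data k s s' lam ->
  mut_frame (val k) (exch_pos s.2 k) (exch_neg s.2 k) 1
    (powM s.1) (fun _ _ => 1) (powM s'.1) (fun _ _ => 1).
Proof.
case=> [[t c] [t' c'] eB f].
have hM := toric_frameP l0 zl oddl t; have hM' := toric_frameP l0 zl oddl t'.
have hq : bichar (qz z lam) by case: hM.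
have [hB hc] : skewB s.2 d /\ forall j (f : V),
    qz z lam (bcol s.2 j) f = (z ^+ d j) ^ f 0 (val j).
  by apply/(compatibleP l0 zl).
split; first by split; apply: powM_frame; eassumption.
- by split; [apply: (exch_pos_k k hB) | apply: (exch_neg_k k hB)].
- by move=> g; rewrite exp1rz.
- by move=> g g0; apply: (mut_fix f); rewrite rvMnE g0 mul0rn.
split=> //; rewrite /powM (frameMn hM') (mut_new f) addrC.
set h1 := exch_pos s.2 k; set h2 := exch_neg s.2 k.
(* The scalar makes [C] the exact quotient of the two monomials. It disappears in [C ^+ l], being an
   l-th root of unity. *)
pose u := (qz z lam h2 (h1 - h2))^-1.
pose C := u *: s.1 (h1 - h2).
have e1 : s.1 h1 = s.1 h2 * C.
  rewrite /C -scalerAr (frameM hM) scalerA mulVf ?(bichar_neq0 hq) // scale1r.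
  by rewrite addrC subrK.
have -> : s.1 h2 + s.1 h1 = s.1 h2 + s.1 h2 * C by rewrite -e1.
(* M(h2) and [C] commute up to z^(2 d_k), which is primitive precisely because l is odd and coprime
   to d_k. *)
have wl : l.-primitive_root (z ^+ (d k * 2)).
  rewrite prim_root_exp_coprime // coprimeMl coprime_sym copd /=.
  by rewrite coprime_sym coprimen2.
rewrite (qpower_sum l0 wl oddl); last first.
  rewrite /C -scalerAr (frame_comm hM) -scalerAl !scalerA mulrC; congr (_ * _ *: _).
  rewrite exprM; congr (_ ^+ 2).
  by rewrite (bicharC hq (h1 - h2)) exch_posB hc (exch_neg_k k hB) invr_expz opprK.
rewrite mulrDr mulr1 -(frameMn hM) addrC; congr (_ + _).
rewrite /C exprZn -(frameMn hM) exprVn (qz_order zl) // invr1 scale1r (frameM hM).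
by rewrite (qz_mull _ _ hq) scale1r -mulrnDl addrC subrK.
Qed.

End Seeds.

(** * The Laurent phenomenon *)

Section LaurentPhenomenon.

Section Generic.
Variables (K : fieldType) (F : unitAlgType K) (N : nat).
Variable ex : {set 'I_N}.
Local Notation V := 'rV[int]_N.
Variable d : exT ex -> nat.
Implicit Types (B : exmat ex) (k j : exT ex).

Lemma skewB_sign B i j : skewB B d ->
  (0 < B (val j) i) = (B (val i) j < 0) /\ (B (val j) i < 0) = (0 < B (val i) j).
Proof.
by case=> d0 /(_ i j) h; have di := d0 i; have dj := d0 j; split; apply/idP/idP => ?; nia.
Qed.

(** The mutation rule in the shape required by [mut_frame_three]: it relates the two exchange
    relations in direction [i], before and after mutation in direction [j]. *)
Lemma mutB2_pos B i j : skewB B d -> i != j -> 0 <= B (val j) i ->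
  bcol (mutB j (mutB i B)) i = - bcol B i - exch_neg (mutB i B) j *+ `|B (val j) i|%N
    + evec (val j) *+ `|B (val j) i|%N.
Proof.
move=> hB ij a0; apply/rowP => r.
rewrite rvDE [in RHS]rvDE 2!rvNE !rvMnE exch_negE evecE !bcolE.
have hB1 := skewB_mut i hB.
have [->|rj] := eqVneq r (val j).
  by rewrite mutB_row mutB_col (skewB_diag j hB1) minxx; lia.
by rewrite mutBE ?mutB_col //; nia.
Qed.

Lemma mutB2_neg B i j : skewB B d -> i != j -> B (val j) i <= 0 ->
  - bcol (mutB j (mutB i B)) i = bcol B i - exch_pos (mutB i B) j *+ `|B (val j) i|%N
    + evec (val j) *+ `|B (val j) i|%N.
Proof.
move=> hB ij a0; apply/rowP => r.
rewrite rvNE rvDE [in RHS]rvDE rvNE !rvMnE exch_posE evecE !bcolE.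
have hB1 := skewB_mut i hB.
have [->|rj] := eqVneq r (val j).
  by rewrite mutB_row mutB_col (skewB_diag j hB1) maxxx; lia.
by rewrite mutBE ?mutB_col //; nia.
Qed.

Lemma mutation_three B i j dl dl' (M0 M1 M2 M3 : V -> F) q0 q1 q2 q3 :
  skewB B d -> i != j ->
  mut_frame (val i) (exch_pos B i) (exch_neg B i) dl M0 q0 M1 q1 ->
  mut_frame (val j) (exch_pos (mutB i B) j) (exch_neg (mutB i B) j) dl' M1 q1 M2 q2 ->
  mut_frame (val i) (exch_pos (mutB j (mutB i B)) i)
    (exch_neg (mutB j (mutB i B)) i) dl M2 q2 M3 q3 ->
  exists C (h : V) v w, [/\ M3 (evec (val i)) = C *: M0 h + v + w * M1 (evec (val i)),
    C != 0, h 0 (val i) = 1, mspan M0 (fun f : V => f 0 (val i) = 0) v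
    & mspan M0 (fun=> True) w].
Proof.
move=> hB ij m1 m2 m3.
have hB1 := skewB_mut i hB; have hB2 := skewB_mut j hB1.
have vij : val i != val j by apply: contraNneq ij => /val_inj ->.
have vji : val j != val i by rewrite eq_sym.
have [s1 s2] := skewB_sign i j hB.
have B1ij : mutB i B (val i) j = - B (val i) j by rewrite mutB_row.
have B2ji : mutB j (mutB i B) (val j) i = B (val j) i by rewrite mutB_row mutB_col opprK.
rewrite (mut_new m3); set n := `|B (val j) i|%N.
(* The role of [h1] must go to a monomial of the middle exchange that is free of x_i(t1). The sign
   of b_ji decides which one, and the monomials are swapped accordingly. *)
have [a0|a0] := leP 0 (B (val j) i).
  have h1i : exch_neg (mutB i B) j 0 (val i) = 0.
    by rewrite exch_negE (negPf vji) B1ij /=; move: s1 s2 a0 => /=; lia.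
  apply: (mut_frame_three vij m1 (mut_frame_sym m2) h1i (n := n)).
  - by rewrite /n exch_posE (negPf vji) B1ij /=; move: s1 s2 a0 => /=; lia.
  - exact: exch_pos_k hB2.
  - exact: exch_neg_k hB2.
  - by rewrite exch_posE (negPf vij) B2ji /n /=; move: s1 s2 a0 => /=; lia.
  - by rewrite exch_negE (negPf vij) B2ji /=; move: s1 s2 a0 => /=; lia.
  - by rewrite exch_posB (mutB2_pos hB ij a0) -[exch_neg B i - _]opprB exch_posB.
  - exact: (mut_qdiff m3).
rewrite addrC.
have h1i : exch_pos (mutB i B) j 0 (val i) = 0.
  by rewrite exch_posE (negPf vji) B1ij /=; move: s1 s2 a0 => /=; lia.
apply: (mut_frame_three vij (mut_frame_sym m1) m2 h1i (n := n)).
- by rewrite /n exch_negE (negPf vji) B1ij /=; move: s1 s2 a0 => /=; lia.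
- exact: exch_neg_k hB2.
- exact: exch_pos_k hB2.
- by rewrite exch_negE (negPf vij) B2ji /n /=; move: s1 s2 a0 => /=; lia.
- by rewrite exch_posE (negPf vij) B2ji /=; move: s1 s2 a0 => /=; lia.
- by rewrite -[LHS]opprB !exch_posB (mutB2_neg hB ij (ltW a0)).
- exact: (mut_qdiff (mut_frame_sym m3)).
Qed.

(** Clearing is asked for all larger exponents as well, so that the maximum over the finitely many
    monomials of [x] serves them all. *)
Lemma mspan_clear (M : V -> F) (T : F -> Prop) P x :
  T 0 -> (forall x y, T x -> T y -> T (x + y)) -> (forall c x, T x -> T (c *: x)) ->
  (forall f, exists A, forall A', (A <= A')%N -> T (M f * P ^+ A')) ->
  mspan M (fun=> True) x -> exists A, T (x * P ^+ A).
Proof.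
move=> T0 TD TZ hf hx.
suff [A hA] : exists A, forall A', (A <= A')%N -> T (x * P ^+ A') by exists A; apply: hA.
elim: hx => [|c f y _ _ [A2 h2]]; first by exists 0%N => A' _; rewrite mul0r.
have [A1 h1] := hf f; exists (maxn A1 A2) => A'; rewrite geq_max => /andP[a1 a2].
by rewrite mulrDl -scalerAl; apply: TD; [apply/TZ/h1 | apply: h2].
Qed.

End Generic.

Section Laurent.
Variables (K : fieldType) (F : unitAlgType K) (l N : nat) (z : K).
Variable ex : {set 'I_N}.
Local Notation V := 'rV[int]_N.
Hypotheses (l0 : (0 < l)%N) (zl : l.-primitive_root z) (oddl : odd l).
Hypothesis charK : [pchar K] =i pred0.
Hypothesis genK : forall x : K, exists p : {poly rat}, x = (map_poly ratr p).[z].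
Hypothesis Fdiv : forall x : F, x != 0 -> x \is a GRing.unit.
Variable d : exT ex -> nat.
Hypothesis copd : forall k, coprime l (d k).
Hypothesis l1 : (1 < l)%N.
Implicit Types (M : V -> F) (B : exmat ex) (k j : exT ex) (s : qseed F ex).

Local Notation good := (good l z d).
Local Notation mdata := (mutation_data l z d).

Lemma prim_exp_neq1 k : z ^+ d k != 1.
Proof.
rewrite -(expr0 z) (eq_prim_root_expr zl) mod0n.
apply: contraL (copd k) => dk.
by rewrite /coprime (gcdn_idPl dk) gtn_eqF.
Qed.

(** Prescribing the matrix of the form lets the data of consecutive mutations be chained. *)
Lemma qmut_data_lam k s s' lam : toric_frame l z s.1 lam -> compatible l lam s.2 d ->
  qmut l z k s s' -> mdata k s s' lam.
Proof.
move=> t c m; have gs : good s by exists lam.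
have [lam' [[t' c'] [t1 c1] eB f]] := qmut_data l0 zl oddl gs m.
have e : qz z lam' = qz z lam.
  apply: functional_extensionality => g; apply: functional_extensionality => h.
  exact: frame_q_uniq (toric_frameP l0 zl oddl t') (toric_frameP l0 zl oddl t) g h.
have e' : qz z (mutL k s.2 lam') = qz z (mutL k s.2 lam).
  apply: functional_extensionality => g; apply: functional_extensionality => h.
  by rewrite !qz_mutL e.
rewrite e e' in f; split=> //; split.
  by apply: (toric_congr l0 zl oddl t1) => g h; rewrite e'.
apply: (compatible_congr l0 zl (toric_bichar l0 zl oddl t1)) c1 => g h.
by rewrite e'.
Qed.

(** The centralizer of M(l f) is closed under the operations that generate the skew field, so only
    monomials have to be checked, and there q(l f, g) = 1. *)
Lemma powM_central M lam f x : toric_frame l z M lam ->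
  M (f *+ l) * x = x * M (f *+ l).
Proof.
move=> t; have hM := toric_frameP l0 zl oddl t; have hq : bichar (qz z lam) by case: hM.
case: t => _ _ _ _ gen.
apply: (gen (fun u => M (f *+ l) * u = u * M (f *+ l))).
- by move=> g; rewrite (frame_comm hM) (qz_mull zl _ _ hq) expr1n scale1r.
- by rewrite mulr_algl mulr_algr.
- by move=> u v hu hv; rewrite mulrBr mulrBl hu hv.
- by move=> u v hu hv; rewrite mulrA hu -mulrA hv mulrA.
- by move=> u hu; apply: commrV.
Qed.

Lemma powM_span M (P Q : V -> Prop) x : (forall f, P f -> Q (f *+ l)) ->
  mspan (powM l M) P x -> mspan M Q x.
Proof.
move=> PQ; elim=> [|c f y Pf _ IH]; first exact: mspan0.
by apply: mspanS => //; apply: PQ.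
Qed.

(* Otherwise B a i *: b^j = B a j *: b^i for all a; compatibility with column j
   then makes b^i divisible by l, contradicting compatibility with column i. *)
Lemma nonzero_minor B lam (i j : exT ex) : bichar (qz z lam) -> i != j ->
  (forall k (f : V), qz z lam (bcol B k) f = (z ^+ d k) ^ f 0 (val k)) ->
  exists a b, B a i * B b j != B b i * B a j.
Proof.
move=> hq ij hc.
apply: NNPP => hno.
have minor a b : B a i * B b j = B b i * B a j.
  by apply/eqP/negPn/negP => h; apply: hno; exists a, b.
have vij : val i != val j by apply: contraNneq ij => /val_inj ->.
have dvd a : (l%:Z %| B a i)%Z.
  have := hc j (evec (val j)); rewrite evecE eqxx expr1z => e1.
  have : B a i *: bcol B j = B a j *: bcol B i.
    by apply/rowP => r; rewrite !rvZE !bcolE minor mulrC.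
  move/(congr1 (fun v => qz z lam v (evec (val j)))).
  rewrite !(bicharZl hq) e1 hc evecE eq_sym (negPf vij) expr0z exp1rz => e2.
  have {}e2 : z ^ ((d j)%:Z * B a i) = z ^ (0 : int).
    by rewrite expr0z -e2 -exprz_exp.
  move/(prim_expz_eq l0 zl): e2; rewrite mod0z => /dvdz_mod0P.
  by rewrite Gauss_dvdzr // /coprimez /gcdz /= eqz_nat; apply: copd.
have e : bcol B i = (\row_r (B r i %/ l%:Z)%Z : V) *+ l.
  apply/rowP => r; rewrite rvMnE mxE bcolE.
  by rewrite -mulr_natr natz divzK.
have := hc i (evec (val i)); rewrite e (qz_mull zl _ _ hq) evecE eqxx expr1z => /esym /eqP.
by rewrite (negPf (prim_exp_neq1 i)).
Qed.

Section ThreeSeeds.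
Variables (s0 s1 s2 s3 : qseed F ex) (i j : exT ex).
Hypotheses (g0 : good s0) (ij : i != j).
Hypotheses (m1 : qmut l z i s0 s1) (m2 : qmut l z j s1 s2) (m3 : qmut l z i s2 s3).

Local Notation T := (mspan s0.1 (fun=> True)).

Lemma three_seeds x : mspan s1.1 (fun=> True) x -> mspan s3.1 (fun=> True) x -> T x.
Proof.
move=> hx1 hx3.
have [lam [t0 c0]] := g0.
have D0 := qmut_data_lam t0 c0 m1; have [_ [t1 c1] e1 f1] := D0.
have D1 := qmut_data_lam t1 c1 m2; have [_ [t2 c2] e2 f2] := D1.
have D2 := qmut_data_lam t2 c2 m3; have [_ [t3 c3] e3 f3] := D2.
have p1 := powM_mut l0 zl oddl copd D0.
have p2 := powM_mut l0 zl oddl copd D1.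
have p3 := powM_mut l0 zl oddl copd D2.
have hM0 := toric_frameP l0 zl oddl t0.
have hM1 := toric_frameP l0 zl oddl t1.
have hM2 := toric_frameP l0 zl oddl t2.
have hM3 := toric_frameP l0 zl oddl t3.
have free0 := toric_free charK genK t0.
have hq : bichar (qz z lam) by case: hM0.
have [hB hc] : skewB s0.2 d /\ forall j (f : V),
    qz z lam (bcol s0.2 j) f = (z ^+ d j) ^ f 0 (val j).
  by apply/(compatibleP l0 zl).
have vij : val i != val j by apply: contraNneq ij => /val_inj ->.
have vji : val j != val i by rewrite eq_sym.
set B := s0.2 in hB hc f1 p1 *.
rewrite -/B in e1; rewrite e2 e1 in f3 p3; rewrite e1 in f2 p2.
have hB1 := skewB_mut i hB.
pose ei := evec (val i); pose ej := evec (val j).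
pose p := s1.1 (ei *+ l); pose q := s2.1 (ej *+ l); pose r := s3.1 (ei *+ l).
have hp1 i' : 0 <= (exch_pos (mutB i B) j) 0 i' + (val j == i')%:R by rewrite exch_posE; lia.
have hn1 i' : 0 <= (exch_neg (mutB i B) j) 0 i' + (val j == i')%:R by rewrite exch_negE; lia.
have Tp : T p.
  by apply: (mut_nonneg f1); rewrite rvMnE evecE eqxx /=; lia.
have TM2j : T (s2.1 ej).
  rewrite (mut_new f2); apply: mspanD; apply: (mut_nonneg f1).
    by have := hp1 (val i); rewrite (negPf vji) addr0.
  by have := hn1 (val i); rewrite (negPf vji) addr0.
have Tq : T q by rewrite /q (frameMn hM2); apply: (mspan_allX hM0).
have TM3i : T (s3.1 ei).
  have [C [k [v [w [-> _ _ hv hw]]]]] := mutation_three hB ij f1 f2 f3.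
  apply: mspanD; last first.
    apply: (mspan_allM hM0) => //; apply: (mut_nonneg f1).
    by rewrite evecE eqxx.
  by apply: mspanD; [apply/mspanZ/mspan_mon | apply: mspan_all hv].
have Tr : T r by rewrite /r (frameMn hM3); apply: (mspan_allX hM0).
have pC y : p * y = y * p by apply: (powM_central _ _ t1).
have qC' y : q * y = y * q by apply: (powM_central _ _ t2).
have rC y : r * y = y * r by apply: (powM_central _ _ t3).
have pE : p = s0.1 (exch_pos B i *+ l) + s0.1 (exch_neg B i *+ l) by apply: (mut_new p1).
have qE : q = s1.1 (exch_pos (mutB i B) j *+ l) + s1.1 (exch_neg (mutB i B) j *+ l).
  by apply: (mut_new p2).
(* By [mutation_three] for l-th powers, [r] is modulo [p] an invertible monomial of i-degree l plus
   terms of i-degree 0, while [p] is homogeneous of i-degree -l. *)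
have reg_r : regular_mod s0.1 p r.
  have [C [k [v [w [e C0 ki hv hw]]]]] := mutation_three hB ij p1 p2 p3.
  have -> : r = C *: s0.1 (k *+ l) + v + w * p by apply: e.
  apply: (regular_modD hM0) => //; last by apply: powM_span hw.
  rewrite pE; apply: (regular_top hM0 free0 (w := fun f : V => f 0 (val i))) => //.
  - by move=> f g; rewrite rvDE.
  - by rewrite !rvMnE (exch_pos_k i hB) (exch_neg_k i hB).
  - apply: powM_span hv => f fi; rewrite !rvMnE fi ki mul0rn.
    by rewrite pmulrn_lgt0.
have reg_q : regular_mod s0.1 p q.
  have [b0|b0] := eqVneq (B (val i) j) 0.
    have [|a [b ab]] := @nonzero_minor B lam i j hq ij; first by move=> k f; apply: hc.
    (* A grading that vanishes on b^i and not on b^j: [p] is homogeneous for it, while the two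
       monomials of [q] have distinct degrees. *)
    pose w (f : V) := B a i * f 0 b - B b i * f 0 a.
    have wD f g : w (f + g) = w f + w g by rewrite /w !rvDE; ring.
    have w0 : w 0 = 0 by rewrite /w !rv0E !mulr0 subrr.
    have wMn f n : w (f *+ n) = w f *+ n.
      by elim: n => [|n IH]; rewrite ?mulr0n // !mulrS wD IH.
    have wi : w (exch_pos B i) = w (exch_neg B i).
      have -> : exch_pos B i = bcol B i + exch_neg B i by rewrite -exch_posB subrK.
      by rewrite wD /w !bcolE [B b i * _]mulrC subrr add0r.
    have eB : bcol (mutB i B) j = bcol B j.
      apply/rowP => t; rewrite !bcolE; have [->|ti] := eqVneq t (val i).
        by rewrite mutB_row b0 oppr0.
      have ji : j != i by rewrite eq_sym.
      by rewrite (mutBE B ti ji) b0 maxxx !mulr0 !addr0.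
    have wj : w (exch_pos (mutB i B) j) != w (exch_neg (mutB i B) j).
      have -> : exch_pos (mutB i B) j = bcol B j + exch_neg (mutB i B) j by rewrite -eB -exch_posB subrK.
      by rewrite wD -subr_eq0 addrK /w !bcolE subr_eq0.
    have hpi : (exch_pos (mutB i B) j *+ l) 0 (val i) = 0.
      by rewrite rvMnE exch_posE mutB_row b0 (negPf vji); apply: mul0rn.
    have hni : (exch_neg (mutB i B) j *+ l) 0 (val i) = 0.
      by rewrite rvMnE exch_negE mutB_row b0 (negPf vji); apply: mul0rn.
    rewrite qE (mut_fix f1 hpi) (mut_fix f1 hni) pE.
    have wii : w (exch_pos B i *+ l) = w (exch_neg B i *+ l) by rewrite !wMn wi.
    case: (ltgtP (w (exch_pos (mutB i B) j)) (w (exch_neg (mutB i B) j))) => [lt|lt|/eqP].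
    - rewrite [s0.1 (exch_pos (mutB i B) j *+ l) + _]addrC -[s0.1 (exch_neg (mutB i B) j *+ l)]scale1r.
      apply: (regular_top hM0 free0 wD wii) => //; first exact: oner_neq0.
      by apply: mspan_mon; rewrite !wMn ltr_pMn2r.
    - rewrite -[s0.1 (exch_pos (mutB i B) j *+ l)]scale1r.
      apply: (regular_top hM0 free0 wD wii) => //; first exact: oner_neq0.
      by apply: mspan_mon; rewrite !wMn ltr_pMn2r.
    - by rewrite (negPf wj).
  (* When b_ij is nonzero, one monomial of [q] is divisible by [p] and the other is invertible; the
     zero grading then suffices. *)
  have key h h' : q = s1.1 (h *+ l) + s1.1 (h' *+ l) -> h 0 (val i) = 0 ->
      1 <= h' 0 (val i) -> regular_mod s0.1 p q.
    move=> -> hi h'i.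
    have [w ew hw] : exists2 w, s1.1 (h' *+ l) = w * p &
        mspan (powM l s1.1) (fun f : V => 0 <= f 0 (val i)) w.
      by apply: (mut_pos_div p1); apply: (mspan_mon (powM l s1.1) (f := h')).
    have {}hw : T w by apply: powM_span (mut_nonneg_span p1 hw).
    rewrite ew (mut_fix p1 hi : s1.1 (h *+ l) = s0.1 (h *+ l)).
    apply: (regular_modD hM0) => //.
    rewrite pE -[s0.1 (h *+ l)]scale1r -[1 *: _]addr0.
    apply: (regular_top hM0 free0 (w := fun=> 0)) => //; first exact: oner_neq0.
    exact: mspan0.
  have B1ij : mutB i B (val i) j = - B (val i) j by rewrite mutB_row.
  have [bpos|bneg] : 0 < B (val i) j \/ B (val i) j < 0 by lia.
    apply: (key (exch_pos (mutB i B) j) (exch_neg (mutB i B) j)) => //.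
      by rewrite exch_posE (negPf vji) B1ij /=; move: bpos => /=; lia.
    by rewrite exch_negE (negPf vji) B1ij /=; move: bpos => /=; lia.
  apply: (key (exch_neg (mutB i B) j) (exch_pos (mutB i B) j)); first by rewrite addrC.
    by rewrite exch_negE (negPf vji) B1ij /=; move: bneg => /=; lia.
  by rewrite exch_posE (negPf vji) B1ij /=; move: bneg => /=; lia.
have [A hA] : exists A, T (x * p ^+ A).
  apply: (mspan_clear (mspan0 _ _) (@mspanD _ _ _ _ _) (@mspanZ _ _ _ _ _)) hx1 => f.
  exists (`|f 0%R (val i)|)%N => A' hA'.
  rewrite /p -(frameMn hM1) (frameM hM1); apply: mspanZ; apply: (mut_nonneg f1).
  rewrite rvDE !rvMnE evecE eqxx -!mulrnA natz mul1n; nia.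
(* The frames at t0 and t3 agree on monomials free of x_i and x_j, and x_i(t3) and x_j(t2) lie in
   the torus of t0. *)
have nonneg3 (g : V) : 0 <= g 0 (val i) -> 0 <= g 0 (val j) -> T (s3.1 g).
  move=> gi gj; pose a := `|g 0%R (val i)|%N; pose b := `|g 0%R (val j)|%N.
  pose h := g - ei *+ a - ej *+ b.
  have hi : h 0 (val i) = 0.
    by rewrite !(rvDE, rvNE, rvMnE, evecE) eqxx (negPf vji) natz mul0rn /a; lia.
  have hj : h 0 (val j) = 0.
    by rewrite !(rvDE, rvNE, rvMnE, evecE) eqxx (negPf vij) natz mul0rn /b; lia.
  have -> : g = ei *+ a + (ej *+ b + h).
    by rewrite /h [ej *+ b + _]addrC subrK addrC subrK.
  clearbody h.
  rewrite !(frameD hM3); apply: mspanZ; apply: (mspan_allM hM0).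
    by rewrite (frameMn hM3); apply: (mspan_allX hM0).
  apply: mspanZ; apply: (mspan_allM hM0).
    rewrite (frameMn hM3); apply: (mspan_allX hM0).
    by rewrite (mut_fix f3) // evecE (negPf vji).
  by rewrite (mut_fix f3 hi) (mut_fix f2 hj) (mut_fix f1 hi); apply: mspan_mon.
have qrE : q * r = s3.1 ((ej + ei) *+ l).
  have -> : q = s3.1 (ej *+ l).
    by rewrite /q (mut_fix f3) // rvMnE evecE (negPf vji) mul0rn.
  by have := frameM (powM_frame l0 zl oddl t3) ej ei; rewrite scale1r.
have [A2 hA2] : exists A, T (x * (q * r) ^+ A).
  apply: (mspan_clear (mspan0 _ _) (@mspanD _ _ _ _ _) (@mspanZ _ _ _ _ _)) hx3 => f.
  exists (`|f 0%R (val i)| + `|f 0%R (val j)|)%N => A' hA'.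
  rewrite qrE -(frameMn hM3) (frameM hM3); apply: mspanZ; apply: nonneg3.
    rewrite !(rvDE, rvMnE) !evecE eqxx (negPf vji) add0r -!mulrnA natz mul1n; nia.
  rewrite !(rvDE, rvMnE) !evecE eqxx (negPf vij) addr0 -!mulrnA natz mul1n; nia.
apply: (regular_cancel hM0 (p := p) (s := (q * r) ^+ A2)) hA hA2 _ => //.
- by apply: (regular_modX hM0); [apply: (regular_modM hM0) | apply: (mspan_allM hM0)].
- by rewrite /p (frame_unit hM1).
- have qrC y : q * r * y = y * (q * r) by rewrite -mulrA rC mulrA qC' mulrA.
  by move=> y; apply/esym/commrX/esym.
Qed.

End ThreeSeeds.

Fixpoint qpath (ks : seq (exT ex)) s s' : Prop :=
  if ks is k :: ks' then exists2 s1, qmut l z k s s1 & qpath ks' s1 s' else s' = s.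

Lemma qpath_rcons ks k s s' :
  qpath (rcons ks k) s s' <-> exists2 s1, qpath ks s s1 & qmut l z k s1 s'.
Proof.
elim: ks s => [|k' ks IH] s /=.
  by split=> [[s1 m ->]|[s1 -> m]]; [exists s | exists s'].
split=> [[s1 m /IH[s2 h m']]|[s2 [s1 m h] m']].
  by exists s2 => //; exists s1.
by exists s1 => //; apply/IH; exists s2.
Qed.

Lemma qpath_good ks s s' : good s -> qpath ks s s' -> good s'.
Proof.
elim: ks s => [|k ks IH] s gs /=; first by move=> ->.
by case=> s1 m; apply: IH; apply: (qmut_good l0 zl oddl gs m).
Qed.

Lemma laurent ks s s' i : good s -> qpath ks s s' ->
  mspan s.1 (fun=> True) (s'.1 (evec i)).
Proof.
move: {2}(size ks) (leqnn (size ks)) => n; elim: n ks s => [|n IH] [|a [|b ks]] s //.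
1,2: by move=> _ _ /= ->; apply: mspan_mon.
  move=> _ gs /= [s1 m ->]; have [lam [_ _ _ f]] := qmut_data l0 zl oddl gs m.
  by apply: (mut_nonneg f); rewrite evecE; lia.
rewrite /= ltnS => szn gs [s1 m1 [s2 m2 h]].
have gs1 := qmut_good l0 zl oddl gs m1; have gs2 := qmut_good l0 zl oddl gs1 m2.
have [ab|ab] := eqVneq a b.
  have e : s2 = s.
    rewrite -ab in m2; apply: (qmut_det l0 zl oddl gs1 m2).
    exact: (qmut_sym l0 zl oddl gs m1).
  by rewrite e in h; apply: (IH ks) => //; apply: ltnW.
(* Mutating the third seed back in direction [a] gives a fourth one. The target is reached from [s1]
   along [b :: ks] and from [s3] along [a :: ks], both one step shorter. *)
have [s3 m3] := qmut_exists l0 zl oddl charK genK Fdiv a gs2.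
apply: (three_seeds gs ab m1 m2 m3).
  by apply: (IH (b :: ks)) => //; exists s2.
apply: (IH (a :: ks)) => //; first exact: (qmut_good l0 zl oddl gs2 m3).
by exists s2 => //; apply: (qmut_sym l0 zl oddl gs2 m3).
Qed.

End Laurent.
End LaurentPhenomenon.

(** * Paths that return to the same l-th powers *)

Section ReturnPaths.

Variables (K : fieldType) (F : unitAlgType K) (l N : nat) (z : K).
Variable ex : {set 'I_N}.
Local Notation V := 'rV[int]_N.
Hypotheses (l0 : (0 < l)%N) (zl : l.-primitive_root z) (oddl : odd l).
Hypothesis charK : [pchar K] =i pred0.
Hypothesis genK : forall x : K, exists p : {poly rat}, x = (map_poly ratr p).[z].
Hypothesis Fdiv : forall x : F, x != 0 -> x \is a GRing.unit.
Variable d : exT ex -> nat.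
Hypothesis copd : forall k, coprime l (d k).
Implicit Types (M : V -> F) (B : exmat ex) (k j : exT ex) (s : qseed F ex).
Local Notation good := (good l z d).

Section LeadFrames.
Variables (M0 M : V -> F) (lam0 lam : 'M[int]_N) (pos : pred V) (Phi : 'M[int]_N).
Hypotheses (t0 : toric_frame l z M0 lam0) (t : toric_frame l z M lam) (cpos : cone pos).
Hypothesis hlead : forall i, lead M0 pos (M (evec i)) 1 (evec i *m Phi).
Let hM0 : frame M0 (qz z lam0). Proof. exact: (toric_frameP l0 zl oddl t0). Qed.
Let hM : frame M (qz z lam). Proof. exact: (toric_frameP l0 zl oddl t). Qed.
Let hq0 : bichar (qz z lam0). Proof. by case: hM0. Qed.
Let hq : bichar (qz z lam). Proof. by case: hM. Qed.
Let free0 : free_mon M0. Proof. exact: (toric_free charK genK t0). Qed.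

(** Comparing the leading terms of both sides of a commutation relation identifies the squares of
    the two values; odd l gives the values themselves. *)
Lemma lead_q f g : qz z lam f g = qz z lam0 (f *m Phi) (g *m Phi).
Proof.
apply: (biadd_eq (r := fun f g => qz z lam0 (f *m Phi) (g *m Phi))) f g.
- exact: (bichar_neq0 hq).
- by move=> *; apply: (bichar_neq0 hq0).
- exact: (bicharDl hq).
- exact: (bicharDr hq).
- by move=> *; rewrite mulmxDl (bicharDl hq0).
- by move=> *; rewrite mulmxDl (bicharDr hq0).
move=> i j; set q1 := qz z lam _ _; set q0 := qz z lam0 _ _.
have h1 := leadM hM0 cpos (hlead i) (hlead j).
have h2 := leadZ (q1 ^+ 2) (leadM hM0 cpos (hlead j) (hlead i)).
rewrite -(frame_comm hM) addrC in h2.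
have q10 : q1 != 0 by apply: (bichar_neq0 hq).
have q00 : q0 != 0 by apply: (bichar_neq0 hq0).
have [||e _] := lead_uniq hM0 free0 cpos _ _ h1 h2.
- by rewrite !mulf_neq0 ?oner_neq0 ?(bichar_neq0 hq0).
- by rewrite !mulf_neq0 ?oner_neq0 ?expf_neq0 ?(bichar_neq0 hq0).
apply: (mulfI (invr_neq0 q10)); rewrite mulVf //; apply/esym/(odd_root1 oddl).
  rewrite !mul1r -/q0 (bicharC hq0 (evec i *m Phi)) -/q0 in e.
  have {}e : q0 ^+ 2 = q1 ^+ 2 by rewrite expr2 {1}e mulfVK.
  by rewrite exprMn exprVn e mulVf ?expf_neq0.
by rewrite exprMn exprVn !(qz_order zl) ?invr1 ?mulr1.
Qed.

(** The coefficient stays 1 because [lead_q] matches the scalars produced by the two frames.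
    Exponents are nonnegative since the inverse of a variable need not lie in the torus of [M0]. *)
Lemma lead_nonneg (f : V) : (forall i, 0 <= f 0 i) -> lead M0 pos (M f) 1 (f *m Phi).
Proof.
have lD g h : lead M0 pos (M g) 1 (g *m Phi) -> lead M0 pos (M h) 1 (h *m Phi) ->
    lead M0 pos (M (g + h)) 1 ((g + h) *m Phi).
  move=> hg hh; rewrite (frameD hM) mulmxDl.
  suff -> : 1 = (qz z lam g h)^-1 * (1 * 1 * qz z lam0 (g *m Phi) (h *m Phi)).
    by apply/leadZ/leadM.
  by rewrite !mul1r -lead_q mulVf // (bichar_neq0 hq).
have l0' : lead M0 pos (M 0) 1 (0 *m Phi).
  by rewrite mul0mx (frame0 hM) -(frame0 hM0); apply: lead_mon.
move=> f0; rewrite [f]row_sum_delta; elim/big_rec: _ => // i x _ hx.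
apply: (lD) => //; rewrite -/(evec i) -[f 0 i]gez0_abs // -natz scaler_nat.
by elim: `|_|%N => [|n IH]; rewrite ?mulr0n // mulrS; apply: lD.
Qed.

End LeadFrames.

Hypothesis l1 : (1 < l)%N.

(* The exchange relation determines the leading term of the new variable: its two
   monomials have distinct leading exponents, because q (b^k) e_k = z^(d_k) is not
   1. *)
Lemma lead_path pos ks s s' : cone pos -> good s -> qpath l z ks s s' ->
  exists Phi : 'M[int]_N, forall i, lead s.1 pos (s'.1 (evec i)) 1 (evec i *m Phi).
Proof.
move=> cpos gs; elim/last_ind: ks s' => [|ks k IH] s'.
  by move=> /= ->; exists 1%:M => i; rewrite mulmx1; apply: lead_mon.
move=> hp; have /qpath_rcons[s1 h m] := hp; have [Phi hPhi] := IH s1 h.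
have gs1 := qpath_good l0 zl oddl gs h.
have [lam0 [t0 c0]] := gs.
have [lam [[t c] [t' c'] eB f]] := qmut_data l0 zl oddl gs1 m.
have hM0 := toric_frameP l0 zl oddl t0; have hM := toric_frameP l0 zl oddl t.
have hM' := toric_frameP l0 zl oddl t'.
have hq0 : bichar (qz z lam0) by case: hM0.
have hq : bichar (qz z lam) by case: hM.
have free0 := toric_free charK genK t0.
have [hB hc] : skewB s1.2 d /\ forall j (f : V),
    qz z lam (bcol s1.2 j) f = (z ^+ d j) ^ f 0 (val j).
  by apply/(compatibleP l0 zl).
have qE := lead_q t0 t cpos hPhi.

set e := evec (val k); set h1 := exch_pos s1.2 k; set h2 := exch_neg s1.2 k.
(* The exchange exponents are -1 at [k]; multiplying by the old variable makes them nonnegative, as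
   [lead_nonneg] requires. *)
have nn1 i : 0 <= (e + h1) 0 i by rewrite rvDE evecE exch_posE; lia.
have nn2 i : 0 <= (e + h2) 0 i by rewrite rvDE evecE exch_negE; lia.
have L1 := leadZ (qz z lam e h1) (lead_nonneg t0 t cpos hPhi nn1).
have L2 := leadZ (qz z lam e h2) (lead_nonneg t0 t cpos hPhi nn2).
rewrite !mulr1 in L1 L2.
have prodE : s1.1 e * s'.1 e = qz z lam e h1 *: s1.1 (e + h1) + qz z lam e h2 *: s1.1 (e + h2).
  by rewrite (mut_new f) mulrDr !(frameM hM).
have b0 : bcol s1.2 k *m Phi != 0.
  apply/eqP => b0; have := hc k e; rewrite qE b0 (bichar0l hq0) evecE eqxx expr1z => /esym /eqP.
  by rewrite (negPf (prim_exp_neq1 zl copd l1 k)).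
have diff : (e + h1) *m Phi - (e + h2) *m Phi = bcol s1.2 k *m Phi.
  by rewrite -mulmxBl opprD addrACA subrr add0r exch_posB.
(* Here the Laurent phenomenon is essential: it provides the new variable with a leading term, which
   uniqueness then reads off from that of the product. *)
have fin h' : lead s.1 pos (s1.1 e * s'.1 e) (qz z lam e h') ((e + h') *m Phi) ->
    lead s.1 pos (s'.1 e) 1 (h' *m Phi).
  move=> hl; have Ty := laurent l0 zl oddl charK genK Fdiv copd l1 (val k) gs hp.
  have y0 : s'.1 e <> 0 by apply/eqP/(frame_neq0 hM').
  have [c1 [g1 [c10 hy]]] := lead_exists cpos Ty y0.
  have hl' := leadM hM0 cpos (hPhi (val k)) hy; rewrite -/e in hl'.
  have [||e1 e2] := lead_uniq hM0 free0 cpos _ _ hl hl'.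
  - exact: (bichar_neq0 hq).
  - by rewrite !mulf_neq0 ?oner_neq0 ?(bichar_neq0 hq0).
  have {}e2 : g1 = h' *m Phi by apply: (addrI (e *m Phi)); rewrite -e2 mulmxDl.
  rewrite e2 -qE mul1r in e1.
  have -> : 1 = c1.
    by apply: (mulIf (bichar_neq0 hq e h')); rewrite mul1r.
  by rewrite -e2.
have [h' hh'] : exists h', lead s.1 pos (s'.1 e) 1 (h' *m Phi).
  case: (cpos) => _ _ /(_ _ b0) /orP[pb|pb].
    exists h1; apply: fin; rewrite prodE; apply: (leadD_gt cpos L1 L2).
    by rewrite diff.
  exists h2; apply: fin; rewrite prodE addrC; apply: (leadD_gt cpos L2 L1).
  by rewrite -opprB diff.
exists (\matrix_(i, j) if i == val k then (h' *m Phi) 0 j else Phi i j) => i.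
have [->|ik] := eqVneq i (val k).
  rewrite (_ : _ *m _ = h' *m Phi) //.
  by rewrite -rowE; apply/rowP => j; rewrite mxE mxE eqxx.
rewrite (mut_fix f) ?evecE ?(negPf ik) //.
rewrite (_ : _ *m _ = evec i *m Phi) //.
by rewrite /evec -!rowE; apply/rowP => j; rewrite !mxE (negPf ik).
Qed.

Lemma return_trivial ks s s' : good s -> qpath l z ks s s' ->
  (forall i, s'.1 (evec i) ^+ l = s.1 (evec i) ^+ l) -> s'.1 = s.1.
Proof.
move=> gs h eX; have gs' := qpath_good l0 zl oddl gs h.
have [lam [t c]] := gs; have [lam' [t' c']] := gs'.
apply: (toric_ext l0 zl oddl t t') => i.
have hM := toric_frameP l0 zl oddl t.
have hq : bichar (qz z lam) by case: hM.
have freeM := toric_free charK genK t.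
have key pos : cone pos -> lead s.1 pos (s'.1 (evec i)) 1 (evec i).
  move=> cpos; have [Phi /(_ i) hl] := lead_path cpos gs h.
  suff e : evec i *m Phi = evec i by move: hl; rewrite e.
  (* Leading exponents are multiplied by l in an l-th power, and Z^N has no torsion. *)
  have hl1 := leadX hM cpos l (bichar_diag hq _) hl.
  have hl2 := leadX hM cpos l (bichar_diag hq _) (lead_mon s.1 pos (evec i)).
  rewrite eX in hl1.
  have [||_ e] := lead_uniq hM freeM cpos _ _ hl1 hl2; rewrite ?expr1n ?oner_neq0 //.
  apply/rowP => j; have := congr1 (fun v : V => v 0 j) e; rewrite !rvMnE.
  by move/eqP; rewrite eqr_pMn2r // => /eqP.
have [y ey hy] := key _ (lexpos_cone N).
have [y' ey' hy'] := key _ (cone_opp (lexpos_cone N)).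
rewrite ey scale1r -[RHS]addr0; congr (_ + _).
(* The common remainder is supported strictly below [evec i] by [hy] and strictly above it by
   [hy']. *)
have yy : y = y' by apply: (addrI (1 *: s.1 (evec i))); rewrite -ey.
have [pi hpi] := proj_exists (fun g => lexpos (evec i - g)) freeM.
rewrite -(proj_in hpi _ hy) // yy; apply: (proj_out hpi _ hy') => g hg.
case: (lexpos_cone N) => pD p0 _; apply: contraNN p0 => hg'.
by have := pD _ _ hg hg'; rewrite addNr.
Qed.

End ReturnPaths.

(** * The isomorphism of exchange graphs *)

Section ExchangeGraphs.

Lemma sig_ext (T : Type) (P : T -> Prop) (u v : {x | P x}) :
  proj1_sig u = proj1_sig v -> u = v.
Proof. by case: u v => [x px] [y py] /= xy; subst y; congr exist; apply: proof_irrelevance. Qed.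

Lemma inj_surj_bij (T U : Type) (f : T -> U) :
  injective f -> (forall y, exists x, f x = y) -> bijective f.
Proof.
move=> inj surj.
pose g y := proj1_sig (constructive_indefinite_description _ (surj y)).
have gK : cancel g f by move=> y; rewrite /g; case: constructive_indefinite_description.
by exists g => // x; apply: inj; rewrite gK.
Qed.

Variables (K : fieldType) (F : unitAlgType K) (l N : nat) (z : K).
Variable ex : {set 'I_N}.
Local Notation V := 'rV[int]_N.
Hypotheses (l0 : (0 < l)%N) (zl : l.-primitive_root z) (oddl : odd l).
Hypothesis charK : [pchar K] =i pred0.
Hypothesis genK : forall x : K, exists p : {poly rat}, x = (map_poly ratr p).[z].
Hypothesis Fdiv : forall x : F, x != 0 -> x \is a GRing.unit.
Variable d : exT ex -> nat.
Hypothesis copd : forall k, coprime l (d k).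
Implicit Types (M : V -> F) (B : exmat ex) (k j : exT ex) (s : qseed F ex).
Local Notation good := (good l z d).

Definition power_seed s : cseed F ex := (fun i => s.1 (evec i) ^+ l, s.2).

Lemma powM_prod M lam (f : V) : toric_frame l z M lam -> (forall i, 0 <= f 0 i) ->
  powM l M f = \prod_i (M (evec i) ^+ l) ^+ `|f 0%R i|%N.
Proof.
move=> t f0; have hP := powM_frame l0 zl oddl t; have hM := toric_frameP l0 zl oddl t.
have PD g h : powM l M (g + h) = powM l M g * powM l M h by rewrite (frameM hP) scale1r.
rewrite {1}[f]row_sum_delta (big_morph _ PD (frame0 hP)); apply: eq_bigr => i _.
rewrite -/(evec i) -{1}[f 0 i]gez0_abs // -natz scaler_nat (frameMn hP).
by rewrite /powM (frameMn hM).
Qed.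

Lemma qmut_cmut k s s' : good s -> qmut l z k s s' -> cmut k (power_seed s) (power_seed s').
Proof.
move=> gs m; have [lam D] := qmut_data l0 zl oddl gs m.
have [[t c] [t' c'] eB f] := D; have p := powM_mut l0 zl oddl copd D.
have hM := toric_frameP l0 zl oddl t; have hM' := toric_frameP l0 zl oddl t'.
have hP := powM_frame l0 zl oddl t.
split=> //; split=> [j jk|]; rewrite /power_seed /=.
  by rewrite (mut_fix f) // evecE (negPf jk).
rewrite -(frameMn hM) -(frameMn hM').
rewrite -[s'.1 _]/(powM l s'.1 (evec (val k))) (mut_new p) mulrDr.
rewrite -[s.1 (evec _ *+ l)]/(powM l s.1 (evec (val k))) !(frameM hP) !scale1r.
have nn1 i : 0 <= (evec (val k) + exch_pos s.2 k) 0 i by rewrite rvDE evecE exch_posE; lia.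
have nn2 i : 0 <= (evec (val k) + exch_neg s.2 k) 0 i by rewrite rvDE evecE exch_negE; lia.
rewrite (powM_prod t nn1) (powM_prod t nn2).
congr (_ + _); rewrite [RHS]big_mkcond; apply: eq_bigr => i _.
  rewrite rvDE evecE exch_posE addrA subrr add0r.
  by case: (ltgtP 0 (s.2 i k)) => // [h|<-]; rewrite expr0.
rewrite rvDE evecE exch_negE addrA subrr add0r abszN.
by case: (ltgtP (s.2 i k) 0) => // ->; rewrite expr0.
Qed.

Lemma cmut_det k (c c1 c2 : cseed F ex) : c.1 (val k) \is a GRing.unit ->
  cmut k c c1 -> cmut k c c2 -> c1 = c2.
Proof.
move=> u [e1 [f1 h1]] [e2 [f2 h2]].
rewrite (surjective_pairing c1) (surjective_pairing c2) e1 e2; congr (_, _).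
apply: functional_extensionality => i.
have [->|ik] := eqVneq i (val k); last by rewrite f1 ?f2.
by apply: (mulrI u); rewrite h1 h2.
Qed.

Lemma power_seed_unit s i : good s -> (power_seed s).1 i \is a GRing.unit.
Proof.
by case=> lam [t _]; rewrite /= unitrX // (frame_unit (toric_frameP l0 zl oddl t)).
Qed.

Lemma qpath_cat ks ks' s s' s'' :
  qpath l z ks s s' -> qpath l z ks' s' s'' -> qpath l z (ks ++ ks') s s''.
Proof.
by elim: ks s => [|k ks IH] s /= => [->|[s1 m /IH h] /h {}h] //; exists s1.
Qed.

Lemma qpath_rev ks s s' : good s -> qpath l z ks s s' -> qpath l z (rev ks) s' s.
Proof.
elim: ks s => [|k ks IH] s gs /=; first by move=> ->.
case=> s1 m h; rewrite rev_cons; apply/qpath_rcons; exists s1.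
  by apply: IH h; apply: (qmut_good l0 zl oddl gs m).
exact: (qmut_sym l0 zl oddl gs m).
Qed.

Lemma power_seed_inj s s' ks : good s -> qpath l z ks s s' ->
  power_seed s' = power_seed s -> s' = s.
Proof.
move=> gs h [e1 e2]; rewrite (surjective_pairing s) (surjective_pairing s') e2; congr (_, _).
have eX i : s'.1 (evec i) ^+ l = s.1 (evec i) ^+ l by exact: (congr1 (@^~ i) e1).
(* [return_trivial] relies on z^(d_k) being different from 1, hence on l > 1; for l = 1 the powers
   are the variables themselves. *)
have [l1|l1] := ltnP 1 l; first exact: (return_trivial l0 zl oddl charK genK Fdiv copd l1 gs h).
have l_1 : l = 1%N by apply/eqP; rewrite eqn_leq l1.
have [lam [t _]] := gs; have [lam' [t' _]] := qpath_good l0 zl oddl gs h.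
by apply: (toric_ext l0 zl oddl t t') => i; have := eX i; rewrite l_1.
Qed.

Variable s0 : qseed F ex.
Hypothesis gs0 : good s0.
Local Notation qreach := (reach (@qmut K F l N z ex) s0).
Local Notation creach := (reach (@cmut K F N ex) (power_seed s0)).

Lemma qreach_good s : qreach s -> good s.
Proof. by elim=> // y w k _ gy m; apply: (qmut_good l0 zl oddl gy m). Qed.

Lemma qreach_path s : qreach s -> exists ks, qpath l z ks s0 s.
Proof.
elim=> [|y w k _ [ks h] m]; first by exists [::].
by exists (rcons ks k); apply/qpath_rcons; exists y.
Qed.

Lemma qreach_vertex s : qreach s -> qvertex l z s0 s.
Proof.
move=> r; split=> //; have [lam [t c]] := qreach_good r.
by exists lam, d.
Qed.

Lemma qreach_creach s : qreach s -> creach (power_seed s).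
Proof.
elim=> [|y w k r IH m]; first exact: reach_refl.
by apply: reach_step IH _; apply: qmut_cmut m; apply: qreach_good.
Qed.

Lemma creach_lift c : creach c -> exists2 s, qreach s & power_seed s = c.
Proof.
elim=> [|y w k _ [s r <-] m]; first by exists s0 => //; apply: reach_refl.
have gs := qreach_good r.
have [s' m'] := qmut_exists l0 zl oddl charK genK Fdiv k gs.
exists s'; first exact: reach_step r m'.
exact: cmut_det (power_seed_unit _ gs) (qmut_cmut gs m') m.
Qed.

(** Reversing the path to [s'] and following the path to [s] gives a path between two seeds with
    equal l-th powers. *)
Lemma qreach_inj s s' : qreach s -> qreach s' -> power_seed s = power_seed s' -> s = s'.
Proof.
move=> r r' e; have [ks h] := qreach_path r; have [ks' h'] := qreach_path r'.
apply: (power_seed_inj (qreach_good r') (qpath_cat (qpath_rev gs0 h') h) e).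
Qed.

Definition power_vertex (u : {s | qvertex l z s0 s}) : {c | cvertex (power_seed s0) c} :=
  exist _ (power_seed (proj1_sig u)) (qreach_creach (proj1 (proj2_sig u))).

Lemma power_vertex_bij : bijective power_vertex.
Proof.
apply: inj_surj_bij => [u v /(congr1 (@proj1_sig _ _)) /= e|[c hc]].
  apply: sig_ext; apply: qreach_inj e.
    exact: (proj1 (proj2_sig u)).
  exact: (proj1 (proj2_sig v)).
have [s r e] := creach_lift hc; exists (exist _ s (qreach_vertex r)).
exact: sig_ext.
Qed.

Lemma power_vertex_edge u v k :
  qmut l z k (proj1_sig u) (proj1_sig v) <->
  cmut k (proj1_sig (power_vertex u)) (proj1_sig (power_vertex v)).
Proof.
case: u v => [s [r hs]] [s' [r' hs']] /=; have gs := qreach_good r.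
split=> [|m]; first exact: qmut_cmut.
(* A classical edge determines its end, so the quantum mutation [s1] and the given [s'] have the
   same l-th powers, and injectivity identifies them. *)
have [s1 m1] := qmut_exists l0 zl oddl charK genK Fdiv k gs.
suff -> : s' = s1 by [].
apply: qreach_inj => //; first exact: reach_step r m1.
exact: cmut_det (power_seed_unit _ gs) m (qmut_cmut gs m1).
Qed.

Lemma power_vertex_unique (phi : {s | qvertex l z s0 s} -> {c | cvertex (power_seed s0) c}) :
  (forall u v (k : exT ex), qmut l z k (proj1_sig u) (proj1_sig v) ->
     cmut k (proj1_sig (phi u)) (proj1_sig (phi v))) ->
  (forall u, proj1_sig u = s0 -> proj1_sig (phi u) = power_seed s0) ->
  power_vertex = phi.
Proof.
move=> hE hb; apply: functional_extensionality => -[s hs]; apply: sig_ext => /=.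
have [r _] := hs; elim: r hs => [|y w k r IH m] hs; first by rewrite hb.
have gy := qreach_good r.
have m' := hE (exist _ y (qreach_vertex r)) (exist _ w hs) k m.
rewrite -IH in m'.
exact: cmut_det (power_seed_unit _ gy) (qmut_cmut gy m) m'.
Qed.

End ExchangeGraphs.

Theorem theorem4p8 (K : fieldType) (F : unitAlgType K) (l N : nat) (z : K)
  (ex : {set 'I_N}) (M : 'rV[int]_N -> F) (B : exmat ex) :
  (0 < l)%N ->
  (* K = Q(eps^{1/2}) with eps^{1/2} = z a primitive l-th root of unity *)
  [pchar K] =i pred0 ->
  l.-primitive_root z ->
  (forall x : K, exists p : {poly rat}, x = (map_poly ratr p).[z]) ->
  (* F is a division algebra over K *)
  (forall x : F, x != 0 -> x \is a GRing.unit) ->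
  (* (M, B~) is a root of unity quantum seed satisfying (Coprime) *)
  (exists (lam : 'M[int]_N) (d : exT ex -> nat),
      toric_frame l z M lam /\ compatible l lam B d /\
      odd l /\ (forall k, coprime l (d k))) ->
  exists! phi : {s | qvertex l z (M, B) s} ->
                {c | cvertex ((fun i => M (evec i) ^+ l), B) c},
    bijective phi /\
    (forall u v (k : exT ex),
        qmut l z k (proj1_sig u) (proj1_sig v) <->
        cmut k (proj1_sig (phi u)) (proj1_sig (phi v))) /\
    (forall u, proj1_sig u = (M, B) ->
        proj1_sig (phi u) = ((fun i => M (evec i) ^+ l), B)).
Proof.
move=> l0 charK zl genK Fdiv [lam [d [tM [cM [oddl copd]]]]].
have gs0 : good l z d (M, B) by exists lam.
exists (power_vertex l0 zl oddl copd gs0); split; last first.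
  move=> phi [_ [hE hb]]; apply: power_vertex_unique => // u v k.
  by move/(hE u v k).
split; first exact: (power_vertex_bij l0 zl oddl charK genK Fdiv copd gs0).
split; first by move=> u v k; exact: (power_vertex_edge l0 zl oddl charK genK Fdiv copd gs0 u v k).
by move=> u /= ->.
Qed.
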